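(* Let $\mathcal V$ (followers) and $\mathcal V_L$ (leaders) be finite nonempty disjoint sets, $m\ge1$, and consider the containment control algorithm with static leaders $$\dot x_i(t)=\sum_{j\in\mathcal V,\ j\ne i}a_{ij}(t)\bigl(x_j(t-h_{ij}(t))-x_i(t)\bigr)+\sum_{k\in\mathcal V_L}b_{ik}(t)\bigl(x_k-x_i(t)\bigr),\qquad i\in\mathcal V,$$ where $x_i(t)\in\mathbb R^m$, $x_k\in\mathbb R^m$ ($k\in\mathcal V_L$) are constant, $a_{ij},b_{ik}:[0,\infty)\to[0,\infty)$ are locally Lebesgue integrable and $h_{ij}:[0,\infty)\to[0,\bar h]$ are Lebesgue measurable. This algorithm provides containment if and only if the damped averaging dynamics $$\dot x_i(t)=-d_i(t)x_i(t)+\sum_{j\in\mathcal V,\ j\ne i}a_{ij}(t)\bigl(x_j(t-h_{ij}(t))-x_i(t)\bigr),\quad i\in\mathcal V,\qquad d_i(t)=\sum_{k\in\mathcal V_L}b_{ik}(t),$$ are asymptotically stable.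
   Context: $\bar h\ge0$. For a starting time $t_*\ge0$, the initial condition prescribes $x_i(t_* )$ and $x_i(t_*+s)=\varphi_i(s)$, $s\in[-\bar h,0)$, $i\in\mathcal V$, with $\varphi_i$ bounded Borel; the solution is locally absolutely continuous on $[t_*,\infty)$ and satisfies the equation for almost all $t\ge t_*$. The algorithm provides containment if for every starting time, any initial condition and any positions of the leaders, $\operatorname{dist}(x_i(t),\mathcal C_L)\to0$ as $t\to\infty$ for all $i\in\mathcal V$, where $\mathcal C_L$ is the convex hull of $\{x_k\}_{k\in\mathcal V_L}$ and $\operatorname{dist}$ is the Euclidean distance from a point to a set. The (linear, scalar-valued $x_i(t)\in\mathbb R$) damped system is asymptotically stable if its zero solution is Lyapunov stable (with respect to the supremum norm of initial data, for each $t_*$) and, for every $t_*\ge0$, every solution started at $t_*$ converges to $0$ as $t\to\infty$. *)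

(* Defs.v *)
From HB Require Import structures.
From mathcomp Require Import all_boot all_order all_algebra.
From mathcomp Require Import all_classical all_reals all_analysis.

Set Implicit Arguments.
Unset Strict Implicit.
Unset Printing Implicit Defensive.

Import Order.TTheory GRing.Theory Num.Theory.
Import numFieldNormedType.Exports.

Local Open Scope classical_set_scope.
Local Open Scope ring_scope.

(* A function on [0, +oo[ is a function on R of which
   only the values on [0, +oo[ are ever constrained or used. *)

Section lebesgue_functions.
Context {R : realType}.

(* R with the sigma-algebra of Lebesgue (not only Borel) measurable sets, on
   which completed_lebesgue_measure is defined; the canonical sigma-algebra on
   R is the Borel one. *)
Definition lebesgueType : measurableType _ :=
  caratheodory_type (wlength (R := R) idfun)^*%mu.

Definition lebesgue_measurable (D : set R) (f : R -> R) : Prop :=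
  measurable_fun (D : set lebesgueType) (f : lebesgueType -> R).

Definition locally_lebesgue_integrable (f : R -> R) : Prop :=
  forall T : R, 0 <= T ->
    (@completed_lebesgue_measure R).-integrable
      (`[0, T]%classic : set lebesgueType) (EFin \o f).

End lebesgue_functions.

Section solutions.
Context {R : realType} {V : finType} {E : normedModType R}.

Definition abs_continuous (a b : R) (f : R -> E) : Prop :=
  forall e : R, 0 < e -> exists2 d : R, 0 < d &
    forall (n : nat) (u v : 'I_n -> R),
      (forall k, [/\ a <= u k, u k <= v k & v k <= b]) ->
      trivIset setT (fun k => `]u k, v k[%classic) ->
      \sum_k (v k - u k) < d -> \sum_k `|f (v k) - f (u k)| < e.

Definition locally_abs_continuous (ts : R) (f : R -> E) : Prop :=
  forall T : R, ts <= T -> abs_continuous ts T f.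

Definition bounded_borel (D : set R) (f : R -> E) : Prop :=
  measurable_fun D (f : R -> g_sigma_algebraType (@open E)) /\
  [bounded f s | s in D].

Definition admissible_history (hbar : R) (phi : V -> R -> E) : Prop :=
  forall i, bounded_borel `[- hbar, 0[ (phi i).

Definition initial_condition (ts hbar : R) (x0 : V -> E) (phi : V -> R -> E)
    (x : V -> R -> E) : Prop :=
  forall i, x i ts = x0 i /\
    forall s, - hbar <= s < 0 -> x i (ts + s) = phi i s.

(* Only the values of x on [ts - hbar, +oo[ matter, provided F x i t depends
   only on the values of x on [t - hbar, t]. *)
Definition is_solution (F : (V -> R -> E) -> V -> R -> E) (ts hbar : R)
    (x0 : V -> E) (phi : V -> R -> E) (x : V -> R -> E) : Prop :=
  initial_condition ts hbar x0 phi x /\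
  forall i, locally_abs_continuous ts (x i) /\
    {ae lebesgue_measure, forall t : R, ts <= t ->
      is_derive t (1 : R) (x i) (F x i t)}.

Definition averaging (a h : V -> V -> R -> R) (x : V -> R -> E) (i : V)
    (t : R) : E :=
  \sum_(j | j != i) a i j t *: (x j (t - h i j t) - x i t).

End solutions.

Section euclidean.
Context {R : realType} {m : nat}.

(* The canonical norm on 'rV_m is the maximum norm. *)
Definition euclidean_norm (v : 'rV[R]_m) : R :=
  Num.sqrt (\sum_j v ord0 j ^+ 2).

Definition euclidean_dist (v : 'rV[R]_m) (A : set 'rV[R]_m) : R :=
  inf [set euclidean_norm (v - w) | w in A].

Definition convex_hull (A : set 'rV[R]_m) : set 'rV[R]_m :=
  smallest (@convex_set R 'rV[R]_m) A.

End euclidean.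

Section containment.
Context {R : realType} {V VL : finType}.

Definition containment_field (m : nat) (a h : V -> V -> R -> R)
    (b : V -> VL -> R -> R) (xL : VL -> 'rV[R]_m) (x : V -> R -> 'rV[R]_m)
    (i : V) (t : R) : 'rV[R]_m :=
  averaging a h x i t + \sum_k b i k t *: (xL k - x i t).

Definition provides_containment (m : nat) (hbar : R) (a h : V -> V -> R -> R)
    (b : V -> VL -> R -> R) : Prop :=
  forall (ts : R) (x0 : V -> 'rV[R]_m) (phi : V -> R -> 'rV[R]_m)
    (xL : VL -> 'rV[R]_m) (x : V -> R -> 'rV[R]_m),
    0 <= ts -> admissible_history hbar phi ->
    is_solution (containment_field a h b xL) ts hbar x0 phi x ->
    forall i, euclidean_dist (x i t) (convex_hull (range xL))
      @[t --> +oo] --> (0 : R).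

End containment.

Section damped.
Context {R : realType} {V : finType}.

Definition damped_field (a h : V -> V -> R -> R) (d : V -> R -> R)
    (x : V -> R -> R) (i : V) (t : R) : R :=
  - d i t * x i t + averaging a h x i t.

(* The sup norm of the initial data (x0, phi) is at most delta iff all the
   values x0 i and phi i s are. *)
Definition lyapunov_stable (hbar : R) (a h : V -> V -> R -> R)
    (d : V -> R -> R) : Prop :=
  forall ts e : R, 0 <= ts -> 0 < e -> exists2 delta : R, 0 < delta &
    forall (x0 : V -> R) (phi : V -> R -> R) (x : V -> R -> R),
      admissible_history hbar phi ->
      is_solution (damped_field a h d) ts hbar x0 phi x ->
      (forall i, `|x0 i| <= delta) ->
      (forall i s, - hbar <= s < 0 -> `|phi i s| <= delta) ->
      forall i t, ts <= t -> `|x i t| < e.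

Definition attractive (hbar : R) (a h : V -> V -> R -> R)
    (d : V -> R -> R) : Prop :=
  forall (ts : R) (x0 : V -> R) (phi : V -> R -> R) (x : V -> R -> R),
    0 <= ts -> admissible_history hbar phi ->
    is_solution (damped_field a h d) ts hbar x0 phi x ->
    forall i, x i t @[t --> +oo] --> (0 : R).

Definition asymptotically_stable (hbar : R) (a h : V -> V -> R -> R)
    (d : V -> R -> R) : Prop :=
  lyapunov_stable hbar a h d /\ attractive hbar a h d.

End damped.

(* Main.v *)
Require Import Defs.
From HB Require Import structures.
From mathcomp Require Import all_boot all_order all_algebra.
From mathcomp Require Import all_classical all_reals all_analysis.
From mathcomp Require Import measurable_realfun.
From mathcomp Require Import ring lra.

Set Implicit Arguments.
Unset Strict Implicit.
Unset Printing Implicit Defensive.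

Import Order.TTheory GRing.Theory Num.Theory.
Import numFieldNormedType.Exports.

Local Open Scope classical_set_scope.
Local Open Scope ring_scope.

(** Write [d i = \sum_k b i k].  The leaders act linearly: each coordinate of the
    containment algorithm is the damped dynamics with the external input
    [\sum_k xi k * b i k], where [xi k] is that coordinate of leader [k]
    ([coord_containment_field]).  So one studies the scalar system
    [x' = - d x + averaging + g], called [forced_field], whose solutions
    superpose ([forced_solution_lin], [forced_solution_sum]), and which is
    positive: an input [g >= 0] and nonnegative initial data give a nonnegative
    solution ([forced_solution_ge0]).

    From containment to stability.  With all leaders at the origin, the distance
    to their hull is the norm, and the algorithm on a line is the damped
    dynamics; so containment makes the damped dynamics attractive.  Lyapunov
    stability holds in any case: a constant [M] solves the system with input
    [M * d >= 0], hence so do [M + x] and [M - x] for a damped solution [x], and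
    if the initial data are bounded by [M], positivity gives [`|x| <= M].

    From stability to containment.  Let [w k] be the solution with input
    [b i k] and zero initial data ([leader_influence_exists]); it is
    nonnegative.  The constant [1] has input [d], the sum of the inputs of the
    [w k], so [r = 1 - \sum_k w k] is a damped solution: it is nonnegative and
    tends to zero.  In the same way [x - \sum_k w k *: xL k] is a damped solution
    coordinatewise, and tends to zero.  Hence [x] is asymptotic to
    [\sum_k w k *: xL k + r *: xL k0], a convex combination of the leaders.

    Two analytic facts carry this.  Positivity rests on the monotonicity of
    absolutely continuous functions whose derivative is nonnegative almost
    everywhere ([abs_continuous_ge0_derive]), applied after multiplication by an
    integrating factor.  Existence ([forced_solution_exists]) comes from the
    monotone iteration of the variation of constants formula, and needs that
    the primitive of a locally integrable function is absolutely continuous and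
    differentiable almost everywhere.  The coefficients are only Lebesgue
    measurable; they are first replaced by almost everywhere equal Borel
    functions ([borel_coefficients]). *)

(** * Induction on real intervals and absolutely continuous functions *)

(** Consider the infimum of the points where [P] fails: the first hypothesis
    gives [P] there, and the second one pushes the failures further right. *)
Lemma real_induction {R : realType} (a : R) (P : R -> Prop) :
  (forall t, a <= t -> (forall s, a <= s < t -> P s) -> P t) ->
  (forall t, a <= t -> P t -> exists2 r, t < r & forall s, t < s < r -> P s) ->
  forall t, a <= t -> P t.
Proof.
move=> Pleft Pright t0 at0; apply: contrapT => nPt0.
pose S := [set t : R | a <= t /\ ~ P t].
have St0 : S t0 by [].
have lbS : has_inf S by split; [exists t0|exists a => t []].
have atau : a <= inf S by apply: lb_le_inf => [|t []//]; exists t0.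
have Plt s : a <= s < inf S -> P s.
  move=> /andP[as_ st]; apply: contrapT => nPs.
  have : inf S <= s by apply: ge_inf; [exact: lbS.2|split].
  by rewrite leNgt st.
have Ptau := Pleft _ atau Plt.
have [r tr Pr] := Pright _ atau Ptau.
suff : r <= inf S by rewrite leNgt tr.
apply: lb_le_inf; first by exists t0.
move=> s [as_ nPs]; rewrite leNgt; apply/negP => sr; apply: nPs.
have [st|ts|->//] := ltgtP s (inf S); first by apply: Plt; rewrite as_.
by apply: Pr; rewrite ts.
Qed.

(** Induction along a chain of small steps from [a] to [b], each of which starts
    or ends at the point whose neighbourhood licenses it.  Since a step may end
    at that point, [P] need not be closed under limits: this suits a [P] that
    asserts the existence of a witness growing at each step. *)
Lemma real_chain_induction {R : realType} (a b : R) (P : R -> Prop) :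
  P a ->
  (forall t, a <= t <= b -> exists2 r, 0 < r &
    forall y z, a <= y -> y <= z -> z <= b -> y = t \/ z = t ->
      z - y < r -> P y -> P z) ->
  forall t, a <= t <= b -> P t.
Proof.
move=> Pa step t /andP[at_ tb].
suff : t <= b -> P t by exact.
move: t at_ {tb}; apply: real_induction => [t at_ IH tb|t at_ IH].
  have [<-//|nat] := eqVneq a t.
  have lat : a < t by rewrite lt_neqAle nat.
  have [|r r0 stepr] := step t; first by rewrite at_.
  pose y := Num.max a (t - r / 2).
  have yt : y < t by rewrite gt_max lat /= ltrBlDr ltrDl divr_gt0.
  have ay : a <= y by rewrite le_max lexx.
  apply: (stepr y t) => //; [exact: ltW|by right| |].
    rewrite ltrBlDr -ltrBlDl lt_max; apply/orP; right.
    by rewrite ltrD2l ltrN2 ltr_pdivrMr// ltr_pMr// ltr1n.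
  by apply: IH; [rewrite ay|exact: le_trans (ltW yt) tb].
have [tb|bt] := ltP t b; last first.
  by exists (t + 1) => [|s /andP[ts _] sb]; rewrite ?ltrDl//; have := le_lt_trans bt ts; rewrite ltNge sb.
have [|r r0 stepr] := step t; first by rewrite at_ ltW.
exists (t + r) => [|s /andP[ts sr] sb]; first by rewrite ltrDl.
apply: (stepr t s) => //; [exact: ltW|by left| |exact/IH/ltW].
by rewrite ltrBlDl.
Qed.

Section absolute_continuity.
Context {R : realType}.
Implicit Types (a b t : R).

Lemma abs_continuous_dist (E : normedModType R) a b (f : R -> E) (e : R) :
  abs_continuous a b f -> 0 < e -> exists2 d, 0 < d &
    forall s t, a <= s -> s <= t -> t <= b -> t - s < d -> `|f t - f s| < e.
Proof.
move=> fAC e0; have [d d0 H] := fAC e e0; exists d => // s t as_ st tb tsd.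
have := H 1%N (fun=> s) (fun=> t).
rewrite !big_ord1; apply => //.
by move=> i j _ _ _; rewrite !ord1.
Qed.

Lemma abs_continuous_continuous (E : normedModType R) (f : R -> E) :
  (forall a b, abs_continuous a b f) -> continuous f.
Proof.
move=> fAC x; apply/cvgrPdist_lt => e e0.
have [d d0 H] := abs_continuous_dist (fAC (x - 1) (x + 1)) e0.
have r0 : 0 < Num.min d 1 by rewrite lt_min d0 ltr01.
near=> y.
have : `|x - y| < Num.min d 1 by near: y; exact: cvgr_dist_lt.
rewrite lt_min => /andP[].
have [xy|/ltW yx] := leP x y.
  rewrite distrC !ger0_norm ?subr_ge0// => yxd yx1; rewrite distrC H//; lra.
by rewrite !ger0_norm ?subr_ge0// => yxd yx1; rewrite H//; lra.
Unshelve. all: by end_near. Qed.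

Lemma abs_continuous_bounded (E : normedModType R) a b (f : R -> E) :
  abs_continuous a b f -> exists2 M, 0 < M & forall t, a <= t <= b -> `|f t| <= M.
Proof.
move=> fAC; have [ab|ba] := leP a b; last first.
  by exists 1 => // t /andP[at_ tb]; have := le_lt_trans (le_trans at_ tb) ba; rewrite ltxx.
have [d d0 H] := abs_continuous_dist fAC ltr01.
suff : exists2 M, 0 < M & forall s, a <= s <= b -> `|f s| <= M by [].
pose P t := exists2 M, 0 < M & forall s, a <= s <= t -> `|f s| <= M.
apply: (@real_chain_induction _ a b P); last by rewrite ab lexx.
  exists (`|f a| + 1) => [|s]; first by rewrite ltr_wpDl.
  by rewrite -eq_le => /eqP <-; rewrite lerDl.
move=> t _; exists d => // y z ay yz zb _ zyd [M M0 PM].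
exists (M + 1) => [|s /andP[as_ sz]]; first by rewrite addr_gt0.
have [sy|ys] := leP s y; first by rewrite (le_trans (PM s _)) ?as_// lerDl.
rewrite -(subrK (f y) (f s)) addrC (le_trans (ler_normD _ _))// lerD//.
  by rewrite PM// ay lexx.
rewrite ltW// H//; [exact: ltW|exact: le_trans zb|].
by rewrite (le_lt_trans _ zyd)// lerD2r.
Qed.

(** Covers sums, products and compositions with Lipschitz maps at once. *)
Lemma abs_continuous_le2 (E E1 E2 : normedModType R) a b (C : R)
    (F : R -> E) (f : R -> E1) (g : R -> E2) :
  (forall s t, a <= s -> s <= t -> t <= b ->
     `|F t - F s| <= C * (`|f t - f s| + `|g t - g s|)) ->
  abs_continuous a b f -> abs_continuous a b g -> abs_continuous a b F.
Proof.
move=> Ffg fAC gAC e e0.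
pose C' := `|C| + 1; have C'0 : 0 < C' by rewrite ltr_wpDl.
have e'0 : 0 < e / (C' *+ 2) by rewrite divr_gt0// mulrn_wgt0.
have [d d0 Hf] := fAC _ e'0; have [d' d'0 Hg] := gAC _ e'0.
exists (Num.min d d') => [|n u v uv tI]; first by rewrite lt_min d0.
rewrite lt_min => /andP[/(Hf n u v uv tI) {}Hf /(Hg n u v uv tI) {}Hg].
apply: (@le_lt_trans _ _ (C' * (\sum_(k < n) `|f (v k) - f (u k)| +
    \sum_(k < n) `|g (v k) - g (u k)|))).
  rewrite -big_split/= mulr_sumr ler_sum// => k _.
  have [? ? ?] := uv k; apply: (le_trans (Ffg _ _ _ _ _)) => //.
  by rewrite ler_wpM2r ?addr_ge0// (le_trans (ler_norm _))// lerDl.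
have := ltrD Hf Hg; rewrite -(ltr_pM2l C'0) => /lt_le_trans; apply.
by rewrite le_eqVlt; apply/orP; left; apply/eqP; field; rewrite gt_eqF.
Qed.

Lemma abs_continuous_cst (E : normedModType R) a b (c : E) :
  abs_continuous a b (cst c).
Proof.
move=> e e0; exists 1 => // n u v _ _ _.
by rewrite big1// => k _; rewrite subrr normr0.
Qed.

Lemma abs_continuousD (E : normedModType R) a b (f g : R -> E) :
  abs_continuous a b f -> abs_continuous a b g -> abs_continuous a b (f + g).
Proof.
apply: (@abs_continuous_le2 _ _ _ a b 1) => s t _ _ _.
by rewrite mul1r opprD addrACA ler_normD.
Qed.

Lemma abs_continuous_lipschitz (E E' : normedModType R) a b (C : R)
    (F : R -> E') (f : R -> E) :
  (forall s t, a <= s -> s <= t -> t <= b ->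
     `|F t - F s| <= C * `|f t - f s|) ->
  abs_continuous a b f -> abs_continuous a b F.
Proof.
move=> Ff fAC.
apply: (@abs_continuous_le2 _ _ _ a b C _ _ _ _ fAC (abs_continuous_cst a b (0 : E))).
move=> s t as_ st tb; rewrite /= subrr normr0 addr0; exact: Ff.
Qed.

Lemma abs_continuousM a b (f g : R -> R) :
  abs_continuous a b f -> abs_continuous a b g -> abs_continuous a b (f * g).
Proof.
move=> fAC gAC.
have [M M0 fM] := abs_continuous_bounded fAC.
have [N N0 gN] := abs_continuous_bounded gAC.
apply: (@abs_continuous_le2 _ _ _ a b (M + N) _ f g) => // s t as_ st tb.
have -> : (f * g) t - (f * g) s = f t * (g t - g s) + (f t - f s) * g s.
  by rewrite !fctE; ring.
rewrite (le_trans (ler_normD _ _))// !normrM.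
rewrite [X in _ <= X](_ : _ = (M * `|g t - g s| + `|f t - f s| * N) +
  (N * `|g t - g s| + `|f t - f s| * M)); last by ring.
rewrite ler_wpDr ?addr_ge0 ?mulr_ge0 ?(ltW M0) ?(ltW N0)//.
rewrite lerD// ?ler_wpM2r ?ler_wpM2l//.
  by rewrite fM// tb (le_trans as_).
by rewrite gN// as_ (le_trans st).
Qed.

(** The exponential is Lipschitz on bounded sets, and an absolutely continuous
    function is bounded. *)
Lemma abs_continuous_expR a b (f : R -> R) :
  abs_continuous a b f -> abs_continuous a b (expR \o f).
Proof.
move=> fAC; have [M M0 fM] := abs_continuous_bounded fAC.
have expL x y : x <= y -> y <= M -> `|expR y - expR x| <= expR M * `|y - x|.
  move=> xy yM; rewrite !ger0_norm ?subr_ge0 ?ler_expR//.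
  have -> : expR y - expR x = expR y * (1 - expR (x - y)).
    by rewrite mulrBr mulr1 -expRD (addrC y) subrK.
  rewrite ler_pM ?expR_ge0 ?ler_expR//.
    by rewrite subr_ge0 -expR0 ler_expR subr_le0.
  by have := expR_ge1Dx (x - y); lra.
apply: (@abs_continuous_lipschitz _ _ a b (expR M) _ f) => // s t as_ st tb.
have ft : f t <= M by rewrite (le_trans (ler_norm _))// fM// tb (le_trans as_).
have fs : f s <= M by rewrite (le_trans (ler_norm _))// fM// as_ (le_trans st).
have [fst|/ltW fts] := leP (f s) (f t); first exact: expL.
by rewrite distrC [X in _ * X]distrC expL.
Qed.

End absolute_continuity.

(** * Monotonicity of absolutely continuous functions *)

Section abs_continuous_nondecreasing.
Context {R : realType}.
Notation mu := (@lebesgue_measure R).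
Implicit Types (f : R -> R) (a b t : R).

(** A lower bound on the variation of [f] inside [U] before time [t], certified
    by a finite family to which absolute continuity directly applies. *)
Let jump_bound f (U : set R) a t (B : R) := exists n (u v : 'I_n -> R),
  [/\ forall k, [/\ a <= u k, u k <= v k & v k <= t],
      trivIset setT (fun k => `]u k, v k[%classic),
      forall k, `]u k, v k[%classic `<=` U &
      B <= \sum_k `|f (v k) - f (u k)|].

Let jump_bound0 f U a t B : B <= 0 -> jump_bound f U a t B.
Proof.
move=> B0; exists 0%N, (fun=> 0), (fun=> 0).
by split; [case|case|case|rewrite big_ord0].
Qed.

Let jump_boundW f U a t t' B B' : t <= t' -> B' <= B ->
  jump_bound f U a t B -> jump_bound f U a t' B'.
Proof.
move=> tt' B'B [n [u [v [uv tI uvU BS]]]]; exists n, u, v; split => //.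
  by move=> k; have [? ? ?] := uv k; split => //; exact: le_trans tt'.
exact: le_trans BS.
Qed.

Let jump_bound_cat f (U : set R) a t t' B : a <= t -> t <= t' ->
  `]t, t'[%classic `<=` U -> jump_bound f U a t B ->
  jump_bound f U a t' (B + `|f t' - f t|).
Proof.
move=> at_ tt' ttU [n [u [v [uv tI uvU BS]]]].
(* append one interval at index [ord_max] to a family indexed by ['I_n] *)
pose ext (w : 'I_n -> R) x (k : 'I_n.+1) :=
  if unlift ord_max k is Some k' then w k' else x.
have extw w x k : ext w x (widen_ord (leqnSn n) k) = w k.
  rewrite /ext (_ : widen_ord _ k = lift ord_max k) ?liftK//.
  by apply/val_inj; rewrite /= /bump leqNgt ltn_ord.
have extx w x : ext w x ord_max = x by rewrite /ext unlift_none.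
exists n.+1, (ext u t), (ext v t'); split.
- move=> k; rewrite /ext; case: unliftP => [k' _|_]; last by split.
  by have [? ? ?] := uv k'; split => //; exact: le_trans tt'.
- move=> i j _ _; rewrite /ext; case: unliftP => [i' ->|->]; case: unliftP => [j' ->|->]//=.
  + by move=> /(tI _ _ I I) ->.
  + move=> [x [/=]]; rewrite !in_itv/= => /andP[_ xv] /andP[tx _].
    have [_ _ vt] := uv i'.
    by have := lt_trans (lt_le_trans xv vt) tx; rewrite ltxx.
  + move=> [x [/=]]; rewrite !in_itv/= => /andP[tx _] /andP[_ xv].
    have [_ _ vt] := uv j'.
    by have := lt_trans (lt_le_trans xv vt) tx; rewrite ltxx.
- by move=> k; rewrite /ext; case: unliftP => [k' _|_].
- rewrite big_ord_recr/= !extx lerD2r.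
  by under eq_bigr do rewrite !extw.
Qed.

Lemma negligible_open_cover (N : set R) (d : R) : mu.-negligible N -> 0 < d ->
  exists U : set R, [/\ open U, N `<=` U & (mu U < d%:E)%E].
Proof.
move=> [B [mB muB NB]] d0.
have [|U [oU BU muU]] := lebesgue_regularity_outer mB _ d0.
  by rewrite [X in (X < _)%E](_ : _ = 0%E).
exists U; split => //; first exact: subset_trans BU.
rewrite -(setDUK BU) (le_lt_trans (measureU2 _ _ _))//.
  by apply: measurableD => //; exact: open_measurable.
by rewrite [X in (X + _)%E](_ : _ = 0%E) ?add0e.
Qed.

Lemma measure_bigsetU_itv n (u v : 'I_n -> R) : (forall k, u k <= v k) ->
  trivIset setT (fun k => `]u k, v k[%classic) ->
  mu (\big[setU/set0]_(k < n) `]u k, v k[%classic) = (\sum_k (v k - u k))%:E.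
Proof.
move=> uv tI; transitivity (\sum_(k < n) mu `]u k, v k[%classic)%E.
  by apply: measure_semi_additive_ord => //; exact: bigsetU_measurable.
rewrite -sumEFin; apply: eq_bigr => k _.
rewrite lebesgue_measure_itv/= lte_fin; case: ltP => // vu.
have -> : v k = u k by apply/eqP; rewrite eq_le vu uv.
by rewrite subrr.
Qed.

Let sum_lengths_le (U : set R) n (u v : 'I_n -> R) : open U ->
  (forall k, u k <= v k) -> trivIset setT (fun k => `]u k, v k[%classic) ->
  (forall k, `]u k, v k[%classic `<=` U) ->
  ((\sum_k (v k - u k))%:E <= mu U)%E.
Proof.
move=> oU uv tI uvU; rewrite -measure_bigsetU_itv//.
apply: le_measure; rewrite ?inE.
- by apply: bigsetU_measurable => k _; exact: measurable_itv.
- exact: open_measurable.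
- by elim/big_ind : _ => // A B AU BU; rewrite subUset.
Qed.

Lemma derive_ge_near f t l e : is_derive t (1 : R) f l -> 0 <= l -> 0 < e ->
  exists2 r, 0 < r & forall y z, y <= z -> y = t \/ z = t -> z - y < r ->
    f y - e * (z - y) <= f z.
Proof.
move=> [fd fl] l0 e0.
have : h^-1 *: (f (h *: (1 : R) + t) - f t) @[h --> 0^'] --> l.
  by rewrite -fl; exact: fd.
move=> /cvgrPdist_lt/(_ _ e0) [r /= r0 H]; exists r => // y z yz yt zyr.
have [->|nyz] := eqVneq y z; first by rewrite subrr mulr0 subr0.
have {}yz : y < z by rewrite lt_neqAle nyz.
case: yt => ?; subst t.
  have := H (z - y); rewrite /ball_/= sub0r normrN gtr0_norm ?subr_gt0//.
  move=> /(_ zyr); rewrite subr_eq0 eq_sym => /(_ nyz).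
  rewrite /GRing.scale/= mulr1 subrK ltr_distlC => /andP[+ _].
  rewrite ltr_pdivlMl ?subr_gt0// => fyz.
  have : 0 <= (z - y) * l by rewrite mulr_ge0// subr_ge0 ltW.
  by move: fyz; rewrite mulrBr; lra.
have := H (y - z); rewrite /ball_/= sub0r normrN distrC gtr0_norm ?subr_gt0//.
move=> /(_ zyr); rewrite subr_eq0 => /(_ nyz).
rewrite /GRing.scale/= mulr1 subrK ltr_distlC => /andP[+ _].
rewrite ltr_ndivlMl ?subr_lt0// => fyz.
have : 0 <= (z - y) * l by rewrite mulr_ge0// subr_ge0 ltW.
by move: fyz; rewrite mulrBr; lra.
Qed.

(** The exceptional null set is covered by an open set [U] so small that, by
    absolute continuity, [f] varies by less than [e] over disjoint intervals
    inside [U].  Going from [a] to [b], one crosses the points of [U] along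
    such intervals, and near every other point [f] decreases at rate at most
    [e]. *)
Lemma abs_continuous_ge0_derive a b f : a <= b -> abs_continuous a b f ->
  {ae mu, forall t, a <= t <= b -> exists2 l, is_derive t (1 : R) f l & 0 <= l} ->
  f a <= f b.
Proof.
move=> ab fAC fae; apply/ler_addgt0Pl => e' e'0.
(* [e * (b - a)] is lost to the slope and [e] to the jumps inside [U] *)
pose e := e' / (1 + (b - a)).
have e0 : 0 < e by rewrite divr_gt0// ltr_wpDr// subr_ge0.
have e'E : e' = e + e * (b - a).
  by rewrite /e; field; rewrite gt_eqF// ltr_wpDr// subr_ge0.
have [d d0 fd] := fAC e e0.
have [U [oU NU muU]] := negligible_open_cover fae d0.
have : jump_bound f U a b (f a - f b - e * (b - a)).
  apply: (@real_chain_induction _ a b (fun t => jump_bound f U a t (f a - f t - e * (t - a)))).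
  - by apply: jump_bound0; rewrite !subrr mulr0 subr0.
  - move=> t atb; have [Ut|nUt] := pselect (U t).
      have [r /= r0 rU] : nbhs t U by exact: open_nbhs_nbhs.
      exists r => // y z ay yz zb yt zyr.
      have yzU : `]y, z[ `<=` U.
        move=> x /=; rewrite in_itv/= => /andP[yx xz]; apply: rU => /=.
        by rewrite /ball_ /= ltr_norml; case: yt => ?; subst t; lra.
      move=> /(jump_bound_cat ay yz yzU); apply: jump_boundW => //.
      have := ler_norm (f y - f z); rewrite distrC => ?.
      have : 0 <= e * (z - y) by rewrite mulr_ge0 ?subr_ge0// ltW.
      by rewrite !mulrBr; lra.
    have [l fl l0] : exists2 l, is_derive t (1 : R) f l & 0 <= l.
      by apply: contrapT => nl; apply: nUt; apply: NU => H; exact: nl (H atb).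
    have [r r0 fr] := derive_ge_near fl l0 e0.
    exists r => // y z ay yz zb yt zyr; apply: jump_boundW => //.
    by have := fr y z yz yt zyr; rewrite !mulrBr; lra.
  - by rewrite ab lexx.
move=> [n [u [v [uv tI uvU]]]].
have len_lt : \sum_k (v k - u k) < d.
  rewrite -lte_fin (le_lt_trans _ muU)// sum_lengths_le// => k.
  by case: (uv k).
by have := fd _ _ _ uv tI len_lt; rewrite e'E; lra.
Qed.

End abs_continuous_nondecreasing.

(** * Primitives of locally integrable functions *)

Section primitives.
Context {R : realType}.
Notation mu := (@lebesgue_measure R).
Implicit Types (f g : R -> R) (a b t : R).

Lemma locally_integrable_itv f a b :
  locally_integrable setT f -> mu.-integrable `[a, b] (EFin \o f).
Proof.
move=> [mf _ foo]; apply/integrableP; split.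
  by apply/measurable_EFinP; exact: measurable_funTS.
by apply: foo => //; exact: segment_compact.
Qed.

Lemma itv_locally_integrable f : measurable_fun setT f ->
  (forall a b, mu.-integrable `[a, b] (EFin \o f)) -> locally_integrable setT f.
Proof.
move=> mf fi; split => //; first exact: openT.
move=> K _ cK.
have [M [_ KM]] := compact_bounded cK.
have KS : K `<=` `[- (M + 1), M + 1]%classic.
  by move=> x Kx; rewrite /= in_itv/= -ler_norml; apply: KM Kx; rewrite ltrDl.
have /integrableP[_] := fi (- (M + 1)) (M + 1); apply: le_lt_trans.
apply: ge0_subset_integral => //=; first exact: compact_measurable.
by apply/measurable_EFinP; apply: measurableT_comp => //; exact: measurable_funTS.
Qed.

Lemma le_locally_integrable f g : measurable_fun setT g ->
  (forall a b, exists C : R, forall t, a <= t <= b -> `|g t| <= C * `|f t|) ->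
  locally_integrable setT f -> locally_integrable setT g.
Proof.
move=> mg gf fi; apply: itv_locally_integrable => // a b.
have [C gC] := gf a b.
apply: (@le_integrable _ _ _ mu _ _ _ (EFin \o (fun t => C * f t))) => //=.
- by apply/measurable_EFinP; exact: measurable_funTS.
- move=> t; rewrite /= in_itv/= => tab; rewrite lee_fin normrM.
  by rewrite (le_trans (gC _ tab))// ler_wpM2r// ler_norm.
- have H := locally_integrable_itv a b fi.
  by apply: eq_integrable (integrableZl _ C H).
Qed.

Lemma locally_integrable_sum (I : Type) (r : seq I) (P : pred I) (F : I -> R -> R) :
  (forall i, P i -> locally_integrable setT (F i)) ->
  locally_integrable setT (fun t => \sum_(i <- r | P i) F i t).
Proof.
move=> Fi; elim: r => [|i r IH].
  under eq_fun do rewrite big_nil.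
  apply: itv_locally_integrable => // a b.
  exact: integrable0.
case Pi : (P i); under eq_fun do rewrite big_cons Pi; last by [].
exact: (locally_integrableD (Fi _ Pi) IH).
Qed.

Notation prim ts f t := (parameterized_integral mu ts t f).

Lemma primitive_before ts f t : t <= ts -> prim ts f t = 0.
Proof.
rewrite le_eqVlt => /predU1P[->|tts].
  by rewrite /parameterized_integral set_itv1 Rintegral_set1.
by rewrite /parameterized_integral set_itv_ge ?Rintegral_set0// bnd_simp -ltNge.
Qed.

(** Truncating [f] makes it integrable over the whole line, and makes the
    formula for the primitive uniform in the position of [t] relative to [ts]. *)
Let primitive_restrict ts f b t : t <= b ->
  prim ts f t = \int[mu]_(s in `]-oo, t]) (f \_ `[ts, b]) s.
Proof.
move=> tb; rewrite -Rintegral_mkcondr /parameterized_integral; congr Rintegral.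
apply/seteqP; split => s /=; rewrite !in_itv/=.
  by move=> /andP[-> st]; rewrite st (le_trans st).
by move=> [-> /andP[-> _]].
Qed.

(** The integral of [`|f|] over a disjoint union of intervals is small when their
    total length is small.  The interval may contain [ts]: as the primitive
    vanishes before [ts], it is continuous on the whole line. *)
Lemma abs_continuous_primitive ts f a b : locally_integrable setT f ->
  abs_continuous a b (fun t => prim ts f t).
Proof.
move=> fi e e0.
pose fb := f \_ `[ts, b].
have ifb : mu.-integrable setT (EFin \o fb).
  rewrite -restrict_EFin; apply/integrable_restrict => //=.
  by rewrite setTI; exact: locally_integrable_itv.
have mfb : measurable_fun setT fb by move/measurable_int : ifb => /measurable_EFinP.
have [d [d0 fd]] := integral_normr_continuous ifb e0.
exists d => // n u v uv tI uvd.
pose D := \big[setU/set0]_(k < n) `]u k, v k[%classic.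
have mD : measurable D by apply: bigsetU_measurable.
have muD : (mu D < d%:E)%E.
  rewrite /D measure_bigsetU_itv// => k.
  by case: (uv k).
apply: le_lt_trans (fd _ mD muD).
have iS (A : set R) : measurable A -> mu.-integrable A (EFin \o (Num.norm \o fb)).
  by move=> mA; apply: (integrableS measurableT) => //; exact: (integrable_norm ifb).
have -> : \int[mu]_(x in D) `|fb x| =
    \sum_(k < n) \int[mu]_(x in `]u k, v k[) `|fb x|.
  rewrite /Rintegral /D ge0_integral_bigsetU//=.
  - rewrite -sum_fine// => k _; apply: integrable_fin_num => //.
    exact: iS.
  - exact: index_enum_uniq.
  - by apply: sub_trivIset tI.
  - by apply/measurable_EFinP; apply: measurableT_comp => //; exact: measurable_funTS.
apply: ler_sum => k _; have [auk uvk vbk] := uv k.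
rewrite !(@primitive_restrict _ _ b)//; last exact: le_trans vbk.
rewrite Rintegral_itvB//; last exact: (integrableS measurableT).
rewrite -Rintegral_itv_bndo_bndc; last exact: (integrableS measurableT).
by apply: le_normr_Rintegral => //; exact: (integrableS measurableT).
Qed.

Lemma ae_neq (c : R) : {ae mu, forall t, t <> c}.
Proof.
exists [set c]; split => //; first by rewrite lebesgue_measure_set1.
by move=> t /= /contrapT.
Qed.

Lemma is_derive_primitive ts f : locally_integrable setT f ->
  {ae mu, forall t, ts <= t -> is_derive t (1 : R) (fun t => prim ts f t) (f t)}.
Proof.
move=> fi.
have H := FTC1 (a := BLeft ts) (fun y => locally_integrable_itv ts y fi) fi.
have := ae_neq ts; move: H.
apply: filterS2; first exact: (ae_filter_ringOfSetsType mu).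
move=> t + tts tst => -[|Fd FE].
  by rewrite lte_fin lt_neqAle tst andbT; apply/eqP => ?; exact: tts.
by apply: DeriveDef => //; rewrite -derive1E.
Qed.

End primitives.

(** * Borel representatives of Lebesgue measurable functions *)

Section borel_representative.
Context {R : realType}.
Notation mu := (@lebesgue_measure R).
Notation cmu := (@completed_lebesgue_measure R).
Notation L := (@lebesgueType R).

Lemma borel_lebesgue (A : set R) :
  measurable A -> measurable (A : set L).
Proof. exact: sub_caratheodory. Qed.

(** A Lebesgue measurable set is a Borel set up to a null set, because the
    Caratheodory sigma-algebra is the completion of the Borel one. *)
Lemma lebesgue_borel_null (A : set R) : measurable (A : set L) ->
  exists2 B : set R, measurable B & mu.-negligible (A `\` B `|` B `\` A).
Proof.
move=> mA; have : (completed_algebra_gen mu).-sigma.-measurable A.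
  by rewrite completed_caratheodory_measurable.
rewrite g_sigma_completed_algebra_genE => -[B mB [N nN <-]].
exists B => //; apply: negligibleS nN.
by move=> x [[[]//]|[Bx /not_orP[]]].
Qed.

(** Each set [f > q] with [q] rational is a Borel set [B q] up to a null set;
    the representative of [f] at [t] is the supremum of the [q] such that [t]
    lies in [B q]. *)
Lemma borel_representative (D : set R) (f : R -> R) :
  measurable (D : set L) -> lebesgue_measurable D f ->
  exists2 g : R -> R, measurable_fun setT g &
    {ae mu, forall t, D t -> g t = f t}.
Proof.
move=> mD mf.
have mfq (q : rat) : measurable (D `&` [set t | ratr q < f t] : set L).
  have := mf mD `]ratr q, +oo[%classic (measurable_itv _).
  by congr measurable; apply/seteqP; split => t /=; rewrite in_itv/= andbT.
have /choice[B BP] : forall q : rat, exists B : set R, measurable B /\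
    mu.-negligible ((D `&` [set t | ratr q < f t]) `\` B `|`
                     B `\` (D `&` [set t | ratr q < f t])).
  by move=> q; have [B mB nB] := lebesgue_borel_null (mfq q); exists B.
pose u n t : \bar R := if @unpickle rat n is Some q then
  if t \in B q then (ratr q)%:E else -oo%E else -oo%E.
have mu_ n : measurable_fun [set: R] (u n).
  rewrite /u; case: unpickle => [q|]; last exact: measurable_cst.
  apply: measurable_fun_ifT => //; apply: (measurable_fun_bool true).
  rewrite setTI (_ : _ @^-1` _ = B q); first exact: (BP q).1.
  by apply/seteqP; split => x /=; [move/set_mem|move/mem_set].
(* the supremum is taken in the extended reals, as [t] may lie in
   none of the [B q], or in all of them *)
exists (fun t => fine (esups (u ^~ t) 0)).
  apply: measurableT_comp => //.
  exact: measurable_fun_esups.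
pose N := \bigcup_n (if @unpickle rat n is Some q then
  (D `&` [set t | ratr q < f t]) `\` B q `|` B q `\` (D `&` [set t | ratr q < f t])
  else set0).
have : mu.-negligible N.
  apply: negligible_bigcup => n; case: unpickle => [q|]; first exact: (BP q).2.
  exact: negligible_set0.
apply: negligibleS => t /= /not_implyP[Dt gf]; apply: contrapT => nNt; apply: gf.
have nNq q : ~ ((D `&` [set t | ratr q < f t]) `\` B q `|`
                 B q `\` (D `&` [set t | ratr q < f t])) t.
  by move=> Nq; apply: nNt; exists (pickle q); [exact: I|rewrite pickleK].
have Bq q : B q t <-> ratr q < f t.
  split; apply: contraPP; last by move=> Bqt fq; apply: (nNq q); left.
  by move=> fq Bqt; apply: (nNq q); right; split => // -[].
suff -> : esups (u ^~ t) 0 = (f t)%:E by [].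
apply/eqP; rewrite eq_le; apply/andP; split.
  apply: ge_ereal_sup => _ [n _ <-]; rewrite /u; case: unpickle => [q|]; last exact: leNye.
  by case: ifPn; rewrite ?leNye// inE => /Bq /ltW.
apply/lee_addgt0Pr => e e0.
have [q] : exists q : rat, ratr q \in `]f t - e, f t[.
  by have [|q ?] := @rat_in_itvoo R (f t - e) (f t); [rewrite ltrBlDr ltrDl|exists q].
rewrite in_itv/= => /andP[qe qf]; rewrite -leeBlDr//.
apply: (@le_trans _ _ (ratr q)%:E); first by rewrite -EFinB lee_fin ltW.
have uq : u (pickle q) t = (ratr q)%:E by rewrite /u pickleK mem_set//; exact/Bq.
by rewrite -uq; apply: ereal_sup_ubound; exists (pickle q); rewrite //= leq0n.
Qed.

Lemma ae_lebesgue_completed (P : R -> Prop) :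
  {ae mu, forall t, P t} -> {ae cmu, forall t : L, P t}.
Proof.
move=> [A [mA A0 NA]]; exists A; split => //; exact: borel_lebesgue.
Qed.

Lemma locally_lebesgue_integrable_measurable (f : R -> R) :
  locally_lebesgue_integrable f -> lebesgue_measurable `[0, +oo[ f.
Proof.
move=> fi; rewrite /lebesgue_measurable (_ : `[0, +oo[%classic = \bigcup_n `[0, n%:R]%classic).
  apply/measurable_fun_bigcup => n; first exact/borel_lebesgue.
  have /measurable_int := fi n%:R (ler0n _ _).
  by move/measurable_EFinP.
apply/seteqP; split => t /=; last by move=> [n _]/=; rewrite !in_itv/= => /andP[->].
rewrite in_itv/= andbT => t0; exists (Num.trunc t).+1 => //=.
by rewrite in_itv/= t0 ltW// truncnS_gt.
Qed.

(** The Lebesgue measure on Borel sets is the image of the completed one by the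
    identity map. *)
Lemma completed_borel_integral (D : set R) (f : R -> \bar R) : measurable D ->
  measurable_fun setT f -> (forall t, 0 <= f t)%E ->
  (\int[cmu]_(t in (D : set L)) f t = \int[mu]_(t in D) f t)%E.
Proof.
move=> mD mf f0.
have mid : measurable_fun [set: L] (id : L -> measurableTypeR R).
  by move=> _ B mB; rewrite setTI; exact: borel_lebesgue.
transitivity (\int[pushforward cmu (id : L -> measurableTypeR R)]_(t in D) f t)%E.
  rewrite ge0_integral_pushforward//.
  by apply: measurable_funTS.
by apply: eq_measure_integral => A mA _.
Qed.

Lemma measurable_lebesgue_borel d (T : measurableType d) (D : set R) (f : R -> T) :
  measurable_fun setT f -> measurable_fun (D : set L) (f : L -> T).
Proof.
move=> mf mD B mB; apply: measurableI => //; apply: borel_lebesgue.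
by rewrite -[_ @^-1` _]setTI; exact: mf.
Qed.

Lemma borel_representative_ge0 (f : R -> R) :
  locally_lebesgue_integrable f -> (forall t, 0 <= t -> 0 <= f t) ->
  exists g : R -> R, [/\ locally_integrable setT g, forall t, 0 <= g t &
    {ae mu, forall t, 0 <= t -> g t = f t}].
Proof.
move=> fi f0.
have mD : measurable (`[0%R, +oo[%classic : set L) by exact/borel_lebesgue.
have [g mg gf] := borel_representative mD (locally_lebesgue_integrable_measurable fi).
(* zero on the negative half-line, where [f] is not controlled *)
pose g' := (fun t => Num.max 0 (g t)) \_ `[0, +oo[.
have mg' : measurable_fun setT g'.
  apply/(measurable_restrictT _ _).1 => //.
  by apply: measurable_funTS; exact: measurable_maxr.
have g'f : {ae mu, forall t, 0 <= t -> g' t = f t}.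
  move: gf; apply: filterS; first exact: (ae_filter_ringOfSetsType mu).
  move=> t; rewrite /= in_itv/= andbT => gf t0.
  rewrite /g' patchE mem_set/= ?in_itv/= ?t0// gf//.
  by apply/max_idPr; exact: f0.
exists g'; split => //; last first.
  by move=> t; rewrite /g' patchE; case: ifPn => // _; rewrite le_max lexx.
apply: itv_locally_integrable => // a b.
have mE : measurable_fun [set: R] (fun t => `|(EFin \o g') t|%E).
  by apply: measurableT_comp => //; exact/measurable_EFinP.
apply/integrableP; split; first by apply/measurable_EFinP; exact: measurable_funTS.
pose T := Num.max 0 b.
have T0 : 0 <= T by rewrite le_max lexx.
have bT : b <= T by rewrite le_max lexx orbT.
apply: (@le_lt_trans _ _ (\int[mu]_(x in `[0%R, T]) `|(EFin \o g') x|)%E).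
  rewrite [leLHS]integral_mkcond [leRHS]integral_mkcond.
  apply: ge0_le_integral => //=.
  - by move=> x _; apply: erestrict_ge0.
  - by apply/(measurable_restrictT _ _).1 => //; exact: measurable_funTS.
  - by apply/(measurable_restrictT _ _).1 => //; exact: measurable_funTS.
  move=> x _; rewrite !patchE; case: ifPn => xab; last first.
    by case: ifPn => // _; rewrite lee_fin.
  case: ifPn => // /negP xT; rewrite lee_fin /g' patchE.
  case: ifPn => [x0|_]; last by rewrite normr0.
  exfalso; apply: xT; rewrite inE/= in_itv/=.
  move: xab x0; rewrite !inE/= !in_itv/= andbT => /andP[_ xb] ->.
  by rewrite (le_trans xb).
rewrite -completed_borel_integral//.
have /integrableP[mf] := fi T T0; apply: le_lt_trans.
rewrite le_eqVlt; apply/orP; left; apply/eqP.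
apply: (@ae_eq_integral _ L _ cmu).
- exact/borel_lebesgue.
- exact: (@measurable_lebesgue_borel _ _ _ _ mE).
- exact: (measurableT_comp _ mf).
- have := ae_lebesgue_completed g'f.
  apply: (@filterS _ _ (ae_filter_ringOfSetsType cmu)) => t gf' /=; rewrite in_itv/= => /andP[t0 _].
  by rewrite gf'.
Qed.

End borel_representative.

(** * Comparison and positivity for the forced dynamics *)

Section comparison.
Context {R : realType}.
Notation mu := (@lebesgue_measure R).
Notation prim ts f t := (parameterized_integral mu ts t f).

(** If [u' >= - alpha * u] then [u * exp A] is nondecreasing, where [A] is the
    primitive of [alpha] that vanishes at [ts]. *)
Lemma integrating_factor_le (alpha u : R -> R) (ts T : R) : ts <= T ->
  locally_integrable setT alpha -> abs_continuous ts T u ->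
  {ae mu, forall t, ts <= t <= T ->
    exists2 l, is_derive t (1 : R) u l & - alpha t * u t <= l} ->
  u ts <= u T * expR (prim ts alpha T).
Proof.
move=> tsT ialpha uAC uae.
pose A t := prim ts alpha t.
have AAC : abs_continuous ts T A by exact: abs_continuous_primitive.
have -> : u ts = (u * (expR \o A)) ts.
  by rewrite !fctE /A primitive_before// expR0 mulr1.
rewrite -[X in _ <= X]/((u * (expR \o A)) T).
apply: abs_continuous_ge0_derive => //.
  by apply: abs_continuousM => //; exact: abs_continuous_expR.
have := is_derive_primitive ts ialpha; move: uae.
apply: filterS2; first exact: (ae_filter_ringOfSetsType mu).
move=> t uae Aae /andP[tst tT].
have [|l ul lge] := uae; first by rewrite tst.
have Ad := Aae tst.
have eAd : is_derive t (1 : R) (expR \o A) (expR (A t) * alpha t).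
  exact: is_derive1_comp.
exists (u t *: (expR (A t) * alpha t) + expR (A t) *: l).
  exact: is_deriveM.
have -> : u t *: (expR (A t) * alpha t) + expR (A t) *: l =
    expR (A t) * (l - - alpha t * u t).
  by rewrite /GRing.scale/=; ring.
by rewrite mulr_ge0 ?expR_ge0// subr_ge0.
Qed.

End comparison.

Section forced_dynamics.
Context {R : realType} {V : finType}.
Notation mu := (@lebesgue_measure R).
Implicit Types (a h : V -> V -> R -> R) (d g : V -> R -> R).

Definition forced_field a h d g (x : V -> R -> R) i t : R :=
  damped_field a h d x i t + g i t.

Lemma forced_solution_lin a h d g g' ts hbar x0 phi x y0 psi y (c : R) :
  is_solution (forced_field a h d g) ts hbar x0 phi x ->
  is_solution (forced_field a h d g') ts hbar y0 psi y ->
  is_solution (forced_field a h d (fun i t => g i t + c * g' i t)) ts hbar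
    (fun i => x0 i + c * y0 i) (fun i s => phi i s + c * psi i s)
    (fun i t => x i t + c * y i t).
Proof.
move=> [xini xsol] [yini ysol]; split.
  move=> i; have [-> xi] := xini i; have [-> yi] := yini i; split => // s sh.
  by rewrite xi// yi.
move=> i; have [xAC xd] := xsol i; have [yAC yd] := ysol i; split.
  move=> T tsT.
  apply: (@abs_continuous_le2 _ _ _ _ ts T (1 + `|c|) _ (x i) (y i) _
    (xAC _ tsT) (yAC _ tsT)) => s t _ _ _.
  have -> : x i t + c * y i t - (x i s + c * y i s) =
    (x i t - x i s) + c * (y i t - y i s) by ring.
  rewrite (le_trans (ler_normD _ _))// normrM mulrDr !mulrDl !mul1r.
  by rewrite lerD// ?lerDl ?lerDr// mulr_ge0.
move: xd yd; apply: filterS2; first exact: (ae_filter_ringOfSetsType mu).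
move=> t xd yd tst; have {}xd := xd tst; have {}yd := yd tst.
have -> : (fun t => x i t + c * y i t) = x i + (c \*: y i) by [].
have := is_deriveD xd (is_deriveZ c yd); move=> /is_derive_eq; apply.
rewrite /forced_field /damped_field /averaging /GRing.scale/=.
rewrite [X in _ = _ + X + _](_ : _ =
  \sum_(j | j != i) a i j t * (x j (t - h i j t) - x i t) +
  c * \sum_(j | j != i) a i j t * (y j (t - h i j t) - y i t)); first by ring.
by rewrite mulr_sumr -big_split/=; apply: eq_bigr => j _; ring.
Qed.

Lemma forced_solution_cst a h d ts hbar (c : R) :
  is_solution (forced_field a h d (fun i t => c * d i t)) ts hbar
    (fun=> c) (fun _ _ => c) (fun _ _ => c).
Proof.
split => // i; split; first by move=> T _; exact: abs_continuous_cst.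
apply: aeW => t _; apply: (is_derive_eq (is_derive_cst c t 1)).
rewrite /forced_field /damped_field /averaging big1 => [|j _].
  by rewrite addr0 mulNr mulrC addNr.
by rewrite subrr scaler0.
Qed.

Lemma eq_ae_solution (E : normedModType R) (F F' : (V -> R -> E) -> V -> R -> E)
    ts hbar x0 phi x :
  {ae mu, forall t, ts <= t -> forall i, F x i t = F' x i t} ->
  is_solution F ts hbar x0 phi x -> is_solution F' ts hbar x0 phi x.
Proof.
move=> FF' [xini xsol]; split => // i; have [xAC xd] := xsol i; split => //.
move: FF' xd; apply: filterS2; first exact: (ae_filter_ringOfSetsType mu).
by move=> t FF' xd tst; rewrite -FF'//; exact: xd.
Qed.

(** It suffices to prove [- e < x i] for every [e > 0].  A solution cannot cross
    the level [- e] for the first time: up to that time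
    all current and delayed values are at least [- e], so that [u = x i + e]
    satisfies [u' >= - alpha * u], with [alpha] the sum of all the gains of
    [i], and [u] stays positive. *)
Lemma forced_solution_ge0 a h d g ts hbar x0 phi x :
  (forall i j, j != i -> locally_integrable setT (a i j) /\
     forall t, ts <= t -> 0 <= a i j t) ->
  (forall i, locally_integrable setT (d i) /\ forall t, ts <= t -> 0 <= d i t) ->
  (forall i j, j != i -> forall t, ts <= t -> 0 <= h i j t <= hbar) ->
  (forall i t, ts <= t -> 0 <= g i t) ->
  is_solution (forced_field a h d g) ts hbar x0 phi x ->
  (forall i, 0 <= x0 i) ->
  (forall i s, - hbar <= s < 0 -> 0 <= phi i s) ->
  forall i t, ts <= t -> 0 <= x i t.
Proof.
move=> ha hd hh hg [xini xsol] x0_ge0 phi_ge0.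
suff H e : 0 < e -> forall t, ts <= t -> forall i, - e < x i t.
  move=> i t tst; rewrite leNgt; apply/negP => xlt.
  by have := H (- x i t); rewrite oppr_gt0 opprK => /(_ xlt t tst i); rewrite ltxx.
move=> e0; apply: real_induction => t tst => [IH i|Pt].
- pose alpha s := d i s + \sum_(j | j != i) a i j s.
  have ialpha : locally_integrable setT alpha.
    apply: (locally_integrableD (hd i).1).
    by apply: locally_integrable_sum => j /ha[].
  have [xAC xd] := xsol i.
  have uAC : abs_continuous ts t (x i + cst e).
    by apply: abs_continuousD; [exact: xAC|exact: abs_continuous_cst].
  have uae : {ae mu, forall s, ts <= s <= t ->
      exists2 l, is_derive s (1 : R) (x i + cst e) l &
        - alpha s * (x i + cst e) s <= l}.
    have := ae_neq t; move: xd.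
    apply: filterS2; first exact: (ae_filter_ringOfSetsType mu).
    move=> s xd /eqP st /andP[tss sle].
    have {sle st}slt : s < t by rewrite lt_neqAle st.
    have {}xd := xd tss.
    exists (forced_field a h d g x i s + 0); first exact: is_deriveD.
    have xdelay j : j != i -> - e <= x j (s - h i j s).
      move=> ji; have /andP[h0 hb] := hh _ _ ji _ tss.
      have [tsh|tsh] := leP ts (s - h i j s).
        apply/ltW/IH; rewrite tsh/= (le_lt_trans _ slt)//.
        by rewrite gerBl.
      have -> : s - h i j s = ts + (s - h i j s - ts) by ring.
      rewrite (xini j).2; last by lra.
      by rewrite (le_trans (_ : _ <= 0)) ?oppr_le0 ?(ltW e0)// phi_ge0//; lra.
    have avg : - (\sum_(j | j != i) a i j s) * (x i s + e) <=
        averaging a h x i s.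
      rewrite mulNr mulr_suml -sumrN; apply: ler_sum => j ji.
      rewrite /GRing.scale/= -mulrN ler_wpM2l ?(ha _ _ ji).2//.
      by have := xdelay _ ji; lra.
    have dge : 0 <= d i s * e by rewrite mulr_ge0 ?(ltW e0)// (hd i).2.
    have gge := hg i _ tss.
    rewrite !fctE /forced_field /damped_field /alpha.
    by move: avg; rewrite !mulNr !mulrDl !mulrDr; lra.
  have := integrating_factor_le tst ialpha uAC uae.
  rewrite !fctE (xini i).1 => uts.
  have : 0 < (x i t + e) * expR (parameterized_integral mu ts t alpha).
    by apply: lt_le_trans uts; rewrite ltr_wpDl.
  by rewrite pmulr_lgt0 ?expR_gt0//; lra.
- have near_t i : \forall s \near t, t < s -> - e < x i s.
    have xAC : abs_continuous ts (t + 1) (x i).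
      by apply: (xsol i).1; rewrite (le_trans tst)// lerDl.
    have xie : 0 < x i t + e by have := Pt i; lra.
    have [r r0 xr] := abs_continuous_dist xAC xie.
    have r10 : 0 < Num.min r 1 by rewrite lt_min r0 ltr01.
    near=> s => lts.
    have : `|t - s| < Num.min r 1 by near: s; exact: cvgr_dist_lt.
    rewrite distrC gtr0_norm ?subr_gt0// lt_min => /andP[sr s1].
    have st1 : s <= t + 1 by lra.
    by have := xr t s tst (ltW lts) st1 sr; rewrite ltr_norml => /andP[]; lra.
  have [r /= r0 Pr] := @filter_forall _ _ _ _ _ near_t.
  exists (t + r) => [|s /andP[ts_ sr] i].
    by rewrite ltrDl.
  by apply: Pr => //=; rewrite /ball_/= distrC gtr0_norm ?subr_gt0//; lra.
Unshelve. all: by end_near. Qed.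


End forced_dynamics.

(** * The variation of constants formula *)

Section existence.
Context {R : realType}.
Notation mu := (@lebesgue_measure R).
Notation prim ts f t := (parameterized_integral mu ts t f).

(** Solves [y' = - alpha * y + f] with [y ts = 0]. *)
Definition variation_of_constants ts (alpha f : R -> R) (t : R) : R :=
  expR (- prim ts alpha t) * prim ts (fun s => expR (prim ts alpha s) * f s) t.

Notation vc := variation_of_constants.

Section facts.
Variables (ts : R) (alpha : R -> R).
Hypothesis ialpha : locally_integrable setT alpha.
Implicit Types f : R -> R.

Let A := fun t => prim ts alpha t.

Let AAC a b : abs_continuous a b A.
Proof. exact: abs_continuous_primitive. Qed.

Lemma locally_integrable_expR_primitive f : locally_integrable setT f ->
  locally_integrable setT (fun s => expR (A s) * f s).
Proof.
move=> fi; have [mf _ _] := fi.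
apply: le_locally_integrable fi => [|a b].
  apply: measurable_funM => //; apply: measurableT_comp => //.
  by apply: continuous_measurable_fun; exact: abs_continuous_continuous.
have [M M0 MA] := abs_continuous_bounded (abs_continuous_expR (AAC a b)).
exists M => t tab; rewrite normrM ler_wpM2r//; exact: MA.
Qed.

Lemma abs_continuous_variation_of_constants f a b :
  locally_integrable setT f -> abs_continuous a b (vc ts alpha f).
Proof.
move=> fi; apply: (@abs_continuousM _ _ _ (expR \o (fun t => - A t))).
  apply: abs_continuous_expR; apply: (abs_continuous_lipschitz (C := 1)) (AAC a b) => s t _ _ _.
  by rewrite mul1r opprK addrC distrC.
by apply: abs_continuous_primitive; exact: locally_integrable_expR_primitive.
Qed.

Lemma is_derive_variation_of_constants f : locally_integrable setT f ->
  {ae mu, forall t, ts <= t ->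
    is_derive t (1 : R) (vc ts alpha f) (f t - alpha t * vc ts alpha f t)}.
Proof.
move=> fi; have eAfi := locally_integrable_expR_primitive fi.
have := is_derive_primitive ts ialpha; have := is_derive_primitive ts eAfi.
apply: filterS2; first exact: (ae_filter_ringOfSetsType mu).
move=> t Fd Ad tst; have {}Fd := Fd tst; have {}Ad := Ad tst.
have eNAd : is_derive t (1 : R) (expR \o (fun t => - A t))
    (expR (- A t) * - alpha t).
  by apply: is_derive1_comp; exact: is_deriveN.
have := is_deriveM eNAd Fd; move=> /is_derive_eq; apply.
have E : expR (- A t) * expR (A t) = 1 by rewrite -expRD addNr expR0.
rewrite /GRing.scale/= /variation_of_constants -/(A t) -[in RHS](mul1r (f t)) -E.
by ring.
Qed.

Lemma variation_of_constants_before f t : t <= ts -> vc ts alpha f t = 0.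
Proof. by move=> tts; rewrite /variation_of_constants !(primitive_before _ tts) mulr0. Qed.

Lemma variation_of_constants_ge0 f t : (forall s, 0 <= f s) ->
  0 <= vc ts alpha f t.
Proof.
move=> f0; rewrite mulr_ge0 ?expR_ge0// Rintegral_ge0// => s _.
by rewrite mulr_ge0 ?expR_ge0.
Qed.

Lemma le_variation_of_constants f f' t : locally_integrable setT f ->
  locally_integrable setT f' -> (forall s, f s <= f' s) ->
  vc ts alpha f t <= vc ts alpha f' t.
Proof.
move=> fi f'i ff'; rewrite ler_wpM2l ?expR_ge0// le_Rintegral//.
- by apply: locally_integrable_itv; exact: locally_integrable_expR_primitive.
- by apply: locally_integrable_itv; exact: locally_integrable_expR_primitive.
- by move=> s _; rewrite ler_wpM2l ?expR_ge0.
Qed.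

(** For [y] this function, [u = 1 - y] solves [u' = - alpha * u] with
    [u ts = 1], hence stays positive. *)
Lemma variation_of_constants_le1 t : vc ts alpha alpha t <= 1.
Proof.
have [tts|/ltW tst] := leP t ts; first by rewrite variation_of_constants_before.
have yAC := abs_continuous_variation_of_constants ts t ialpha.
have yae := is_derive_variation_of_constants ialpha.
have yts := variation_of_constants_before alpha (lexx ts).
move: (vc ts alpha alpha) yAC yae yts => y yAC yae yts.
have uAC : abs_continuous ts t (cst 1 - y).
  apply: (abs_continuous_lipschitz (C := 1)) yAC => s s' _ _ _.
  rewrite mul1r !fctE (_ : 1 - y s' - (1 - y s) = y s - y s'); last by ring.
  by rewrite distrC.
have uae : {ae mu, forall s, ts <= s <= t ->
    exists2 l, is_derive s (1 : R) (cst 1 - y) l & - alpha s * (cst 1 - y) s <= l}.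
  move: yae; apply: filterS; first exact: (ae_filter_ringOfSetsType mu).
  move=> s sd /andP[tss _]; have {}sd := sd tss.
  exists (0 - (alpha s - alpha s * y s)); first exact: is_deriveB.
  by rewrite !fctE mulrBr mulr1 mulNr; lra.
have := integrating_factor_le tst ialpha uAC uae.
rewrite !fctE yts subr0 => /(lt_le_trans ltr01).
by rewrite pmulr_lgt0 ?expR_gt0// subr_gt0 => /ltW.
Qed.

Lemma measurable_variation_of_constants f : locally_integrable setT f ->
  measurable_fun setT (vc ts alpha f).
Proof.
move=> fi; apply: continuous_measurable_fun.
by apply: abs_continuous_continuous => a b; exact: abs_continuous_variation_of_constants.
Qed.

Lemma cvg_variation_of_constants (f_ : nat -> R -> R) f t :
  (forall n, locally_integrable setT (f_ n)) ->
  locally_integrable setT f ->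
  (forall n s, 0 <= f_ n s <= alpha s) ->
  (forall s, f_ ^~ s @ \oo --> f s) ->
  vc ts alpha (f_ n) t @[n --> \oo] --> vc ts alpha f t.
Proof.
move=> f_i fi f_le f_f.
apply: cvgM; first exact: cvg_cst.
have f_i' n := locally_integrable_expR_primitive (f_i n).
have fi' := locally_integrable_expR_primitive fi.
have ai' := locally_integrable_expR_primitive ialpha.
rewrite /parameterized_integral/=.
have fin (k : R -> R) : locally_integrable setT k ->
    (\int[mu]_(s in `[ts, t]) (k s)%:E)%E \is a fin_num.
  by move=> ki; apply: integrable_fin_num => //; exact: locally_integrable_itv.
apply: fine_cvg; rewrite fineK; last exact: fin.
apply: (dominated_cvg _ _ _ _ (locally_integrable_itv ts t ai')) => //.
- by move=> n; apply/measurable_EFinP/measurable_funTS; have [] := f_i' n.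
- move=> s _; apply: cvg_EFin; first exact: nearW.
  by apply: cvgM; [exact: cvg_cst|exact: f_f].
- move=> n s _; have /andP[f0 fa] := f_le n s.
  by rewrite lee_fin ger0_norm ?mulr_ge0 ?expR_ge0// ler_wpM2l ?expR_ge0.
Qed.

End facts.

End existence.

(** * Existence of solutions *)

Section forced_existence.
Context {R : realType} {V : finType}.
Notation mu := (@lebesgue_measure R).

(** Iterating the variation of constants formula from the zero function gives a
    nondecreasing sequence of functions, bounded by [1] because the constant
    [1] is a supersolution; its limit is a fixed point by dominated
    convergence. *)
Lemma forced_solution_exists (a h : V -> V -> R -> R) (d g : V -> R -> R)
    (ts hbar : R) :
  (forall i j, j != i -> locally_integrable setT (a i j) /\
     forall t, 0 <= a i j t) ->
  (forall i, locally_integrable setT (d i)) ->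
  (forall i j, j != i -> measurable_fun setT (h i j)) ->
  (forall i, locally_integrable setT (g i) /\ forall t, 0 <= g i t <= d i t) ->
  exists x, is_solution (forced_field a h d g) ts hbar (fun=> 0) (fun _ _ => 0) x.
Proof.
move=> ha id mh hg.
pose alpha i t := d i t + \sum_(j | j != i) a i j t.
have ialpha i : locally_integrable setT (alpha i).
  apply: (locally_integrableD (id i)).
  by apply: locally_integrable_sum => j /ha[].
(* The equation reads [y' = - alpha * y + src y]. *)
pose src (y : V -> R -> R) i s :=
  \sum_(j | j != i) a i j s * y j (s - h i j s) + g i s.
(* the class of functions in which the iteration takes place *)
pose good (y : V -> R -> R) := (forall i, measurable_fun setT (y i)) /\
  forall i t, 0 <= y i t <= 1.
have src_le y y' : (forall i t, y i t <= y' i t) -> forall i s, src y i s <= src y' i s.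
  move=> yy' i s; rewrite lerD2r ler_sum// => j ji.
  by rewrite ler_wpM2l// (ha _ _ ji).2.
have src0 y : good y -> forall i s, 0 <= src y i s.
  move=> [_ y01] i s; rewrite addr_ge0// ?(andP ((hg i).2 s)).1//.
  rewrite sumr_ge0// => j ji; rewrite mulr_ge0// ?(ha _ _ ji).2//.
  by case/andP : (y01 j (s - h i j s)).
have src1 y : good y -> forall i s, src y i s <= alpha i s.
  move=> [_ y01] i s; rewrite /alpha addrC lerD// ?(andP ((hg i).2 s)).2//.
  rewrite ler_sum// => j ji; rewrite ler_piMr// ?(ha _ _ ji).2//.
  by case/andP : (y01 j (s - h i j s)).
have isrc y : good y -> forall i, locally_integrable setT (src y i).
  move=> [my y01] i; apply: (locally_integrableD _ (hg i).1).
  apply: locally_integrable_sum => j ji; have [ia _] := ha _ _ ji.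
  apply: le_locally_integrable ia => [|u v].
    apply: measurable_funM; first by have [] := (ha _ _ ji).1.
    apply: measurableT_comp => //; apply: measurable_funB => //.
    exact: mh.
  exists 1 => t _; rewrite mul1r normrM ler_piMr//.
  by have /andP[y0 y1] := y01 j (t - h i j t); rewrite ger0_norm.
pose step y i := variation_of_constants ts (alpha i) (src y i).
have step_good y : good y -> good (step y).
  move=> gy; split=> [i|i t].
    by apply: measurable_variation_of_constants => //; exact: isrc.
  rewrite variation_of_constants_ge0 /=; last exact: src0.
  apply: le_trans (variation_of_constants_le1 ts (ialpha i) t).
  by apply: le_variation_of_constants => //; [exact: isrc|exact: src1].
pose y n := iter n step (fun _ _ => 0).
have gy n : good (y n).
  elim: n => [|n IH]; last exact: step_good.
  by split => [i|i t] /=; [exact: measurable_cst|rewrite lexx ler01].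
have y_nd i t : nondecreasing_seq (fun n => y n i t).
  apply/nondecreasing_seqP => n; elim: n i t => [|n IH] i t.
    by case/andP : ((gy 1%N).2 i t).
  apply: le_variation_of_constants => //.
  - exact: isrc (gy n) i.
  - exact: isrc (gy n.+1) i.
  - exact: src_le.
have y_cvg i t : cvgn (fun n => y n i t).
  apply: nondecreasing_is_cvgn => //; exists 1 => _ [n _ <-].
  by case/andP : ((gy n).2 i t).
pose x i t := limn (fun n => y n i t).
have yx i t : y n i t @[n --> \oo] --> x i t by exact: y_cvg.
have gx : good x.
  split => [i|i t].
    by apply: (measurable_fun_cvg (fun n => (gy n).1 i)) => t _; exact: yx.
  apply/andP; split.
    by apply: limr_ge => //; apply: nearW => n; case/andP : ((gy n).2 i t).
  by apply: limr_le => //; apply: nearW => n; case/andP : ((gy n).2 i t).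
have xE i : x i = step x i.
  apply/funext => t.
  have : y n.+1 i t @[n --> \oo] --> step x i t.
    apply: cvg_variation_of_constants => //.
    - by move=> n; exact: isrc (gy n) i.
    - exact: isrc gx i.
    - by move=> n s; rewrite src0//= src1.
    - move=> s; apply: cvgD; last exact: cvg_cst.
      apply: (cvg_big add_continuous) => j ji; apply: cvgM; first exact: cvg_cst.
      exact: yx.
  have := yx i t; rewrite -(cvg_shiftS (fun n => y n i t)) => yxS ySx.
  exact: (cvg_unique _ yxS ySx).
exists x; split => i.
  split=> [|s /andP[_ s0]]; rewrite xE /step variation_of_constants_before//.
  by rewrite gerDl ltW.
rewrite {1}xE; split.
  by move=> T _; apply: abs_continuous_variation_of_constants => //; exact: isrc.
have := is_derive_variation_of_constants ts (ialpha i) (isrc _ gx i).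
apply: filterS; first exact: (ae_filter_ringOfSetsType mu).
move=> t xd tst; have {}xd := xd tst.
rewrite {1}xE; move: xd => /is_derive_eq; apply.
rewrite -[variation_of_constants _ _ _]/(step x i) -xE.
have avgE : averaging a h x i t = \sum_(j | j != i) a i j t * x j (t - h i j t) -
    (\sum_(j | j != i) a i j t) * x i t.
  by rewrite mulr_suml -sumrB; apply: eq_bigr => j _; rewrite -mulrBr.
by rewrite /forced_field /damped_field avgE /src /alpha; ring.
Qed.

End forced_existence.

(** * Linear images of solutions, Euclidean distance and convex hulls *)

Section linear_images.
Context {R : realType} {V : finType} {E E' : normedModType R}.
Variables (L : {linear E -> E'}) (C : R).
Hypothesis L_le : forall v, `|L v| <= C * `|v|.

Let continuous_L : continuous L.
Proof.
apply/(@linear_bounded_continuous _ _ _ L)/linear_boundedP.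
exists C; split => [|r /ltW Cr v]; first exact: num_real.
by rewrite (le_trans (L_le v))// ler_wpM2r.
Qed.

Lemma is_derive_linear_image (f : R -> E) t l :
  is_derive t (1 : R) f l -> is_derive t (1 : R) (L \o f) (L l).
Proof.
move=> [fd fl].
have cv : (fun k : R => k^-1 *: ((L \o f) (k *: (1 : R) + t) - (L \o f) t)) @ 0^'
    --> L l.
  have -> : (fun k : R => k^-1 *: ((L \o f) (k *: (1 : R) + t) - (L \o f) t)) =
      L \o (fun k : R => k^-1 *: (f (k *: (1 : R) + t) - f t)).
    by apply/funext => k; rewrite /comp -(linearB L) linearZ_LR.
  by rewrite -fl; apply: (cvg_comp _ _ fd); exact: continuous_L.
apply: DeriveDef; first by apply/cvg_ex; exists (L l).
exact: cvg_lim cv.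
Qed.

Lemma bounded_borel_linear_image (D : set R) (f : R -> E) :
  bounded_borel D f -> bounded_borel D (L \o f).
Proof.
move=> [mf bf]; split.
  have mL : measurable_fun setT
      (L : g_sigma_algebraType (@open E) -> g_sigma_algebraType (@open E')).
    apply: (@measurability _ _ (g_sigma_algebraType (@open E)) (g_sigma_algebraType (@open E')) setT L (@open E')) => [|_ [B oB <-]]; first by [].

    rewrite setTI; apply: sub_sigma_algebra.
    by move/continuousP : continuous_L; apply.
  exact: measurableT_comp mL mf.
have [M [_ fM]] := bf; exists (`|C| * (M + 1)); split=> [|N CN s Ds /=].
  exact: num_real.
rewrite (le_trans _ (ltW CN))// (le_trans (L_le _))//.
rewrite (le_trans (ler_wpM2r _ (ler_norm C)))// ler_wpM2l//.
by apply: (fM (M + 1)) => //; rewrite ltrDl.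
Qed.

(** Used to put scalar solutions on a line of the space, and to take
    coordinates of solutions. *)
Lemma linear_image_solution (F : (V -> R -> E) -> V -> R -> E)
    (F' : (V -> R -> E') -> V -> R -> E') ts hbar x0 phi x :
  (forall i t, L (F x i t) = F' (fun j s => L (x j s)) i t) ->
  is_solution F ts hbar x0 phi x ->
  is_solution F' ts hbar (fun i => L (x0 i)) (fun i s => L (phi i s))
    (fun i t => L (x i t)).
Proof.
move=> LF [xini xsol]; split.
  move=> i; have [xi xphi] := xini i; split; first by rewrite xi.
  by move=> s sh; rewrite xphi.
move=> i; have [xAC xd] := xsol i; split.
  move=> T tsT; apply: (abs_continuous_lipschitz (C := C)) (xAC _ tsT).
  by move=> s t _ _ _; rewrite -linearB.
move: xd; apply: filterS; first exact: (ae_filter_ringOfSetsType (@lebesgue_measure R)).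
by move=> t xd tst; rewrite -LF; apply: is_derive_linear_image; exact: xd.
Qed.

End linear_images.

Section euclidean_facts.
Context {R : realType} {m : nat}.
Implicit Types v : 'rV[R]_m.

Lemma euclidean_norm_ge_coord v c : `|v ord0 c| <= euclidean_norm v.
Proof.
rewrite -sqrtr_sqr ler_sqrt ?sumr_ge0// => [|j _]; last exact: sqr_ge0.
by rewrite (bigD1 c)//= lerDl sumr_ge0// => j _; exact: sqr_ge0.
Qed.

Lemma euclidean_norm_le_sum v : euclidean_norm v <= \sum_c `|v ord0 c|.
Proof.
have S0 : 0 <= \sum_c `|v ord0 c| by rewrite sumr_ge0.
rewrite -[leRHS]ger0_norm// -sqrtr_sqr ler_sqrt ?sqr_ge0//.
rewrite [leRHS]expr2 mulr_suml ler_sum// => c _.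
rewrite -real_normK ?num_real// expr2 ler_wpM2l// (bigD1 c)//= lerDl sumr_ge0//.
Qed.

Lemma euclidean_norm_ge0 v : 0 <= euclidean_norm v.
Proof. exact: sqrtr_ge0. Qed.

Lemma euclidean_dist_ge0 v (A : set 'rV[R]_m) : 0 <= euclidean_dist v A.
Proof.
rewrite /euclidean_dist; have [->|] := eqVneq [set euclidean_norm (v - w) | w in A] set0.
  by rewrite inf0.
move=> /set0P A0; apply: lb_le_inf => // _ [w _ <-]; exact: euclidean_norm_ge0.
Qed.

Lemma euclidean_dist_le v w (A : set 'rV[R]_m) : A w ->
  euclidean_dist v A <= euclidean_norm (v - w).
Proof.
move=> Aw; apply: ge_inf; last by exists w.
by exists 0 => _ [u _ <-]; exact: euclidean_norm_ge0.
Qed.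

Lemma convex_hull_range0 (I : Type) (p : I -> 'rV[R]_m) (k : I) :
  (forall i, p i = 0) -> convex_hull (range p) = [set 0].
Proof.
move=> p0; apply/seteqP; split.
  apply: smallest_sub; last by move=> _ [i _ <-]; exact: p0.
  move=> x y lambda; rewrite !inE => -> ->.
  exact: (convmm lambda (0 : convex_lmodType _)).
by move=> _ -> B [_ Bp]; apply: Bp; exists k.
Qed.

(** The induction runs over the normalized partial sums. *)
Lemma convex_hull_sum (I : finType) (p : I -> 'rV[R]_m) (w : I -> R) :
  (forall i, 0 <= w i) -> \sum_i w i = 1 ->
  convex_hull (range p) (\sum_i w i *: p i).
Proof.
move=> w0 w1 B [Bconv Bp].
suff H (s : seq I) : 0 < \sum_(i <- s) w i ->
    B ((\sum_(i <- s) w i)^-1 *: \sum_(i <- s) w i *: p i).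
  have := H (index_enum I); rewrite w1 ltr01 invr1 scale1r; exact.
elim: s => [|i s IH]; first by rewrite big_nil ltxx.
rewrite !big_cons => W0.
have Bpi : B (p i) by apply: Bp; exists i.
have [ws0|ws_gt0] := leP (\sum_(j <- s) w j) 0.
  have wj0 j : j \in s -> w j = 0.
    move=> js; apply/eqP; rewrite eq_le w0 andbT (le_trans _ ws0)//.
    by rewrite (big_rem j)//= lerDl sumr_ge0.
  rewrite !big_seq [\sum_(_ <- _ | _) w _]big1//.
  rewrite [\sum_(_ <- _ | _) _ *: _]big1 => [|j /wj0 ->]; last by rewrite scale0r.
  have wi0 : w i != 0.
    by apply: contraTneq W0 => ->; rewrite add0r -leNgt.
  by rewrite !addr0 scalerA mulVf// scale1r.
set W := w i + _ in W0 *.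
have l0 : 0 <= w i / W by rewrite divr_ge0// ltW.
have l1 : w i / W <= 1 by rewrite ler_pdivrMr// mul1r lerDl ltW.
have := Bconv (p i) _ (Itv01 l0 l1) (mem_set Bpi) (mem_set (IH ws_gt0)).
rewrite inE; congr B; rewrite /conv/= scalerDr !scalerA mulrC; congr (_ + _ *: _).
by rewrite /unstable.onem /W; field; rewrite !gt_eqF.
Qed.

End euclidean_facts.

(** * Reduction to Borel coefficients and superposition *)

Section borel_coefficients.
Context {R : realType} {V VL : finType}.
Notation mu := (@lebesgue_measure R).

(** Replacing the coefficients on a null set of times does not change the
    solutions, so the dynamics may be assumed to have Borel coefficients. *)
Lemma borel_coefficients (hbar : R) (a h : V -> V -> R -> R) (b : V -> VL -> R -> R) :
  0 <= hbar ->
  (forall i j, j != i -> locally_lebesgue_integrable (a i j) /\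
     forall t, 0 <= t -> 0 <= a i j t) ->
  (forall i k, locally_lebesgue_integrable (b i k) /\
     forall t, 0 <= t -> 0 <= b i k t) ->
  (forall i j, j != i -> lebesgue_measurable `[0, +oo[ (h i j) /\
     forall t, 0 <= t -> 0 <= h i j t <= hbar) ->
  exists (a' h' : V -> V -> R -> R) (b' : V -> VL -> R -> R),
  [/\ forall i j, j != i -> locally_integrable setT (a' i j) /\
        forall t, 0 <= a' i j t,
      forall i k, locally_integrable setT (b' i k) /\ forall t, 0 <= b' i k t,
      forall i j, j != i -> measurable_fun setT (h' i j) /\
        forall t, 0 <= h' i j t <= hbar &
      {ae mu, forall t, 0 <= t -> forall i,
        (forall j, j != i -> a' i j t = a i j t /\ h' i j t = h i j t) /\
        forall k, b' i k t = b i k t}].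
Proof.
move=> hbar0 ha hb hh.
have ae_filter := ae_filter_ringOfSetsType mu.
have /choice[a' a'P] : forall ij : V * V, exists f : R -> R, ij.2 != ij.1 ->
    [/\ locally_integrable setT f, forall t, 0 <= f t &
      {ae mu, forall t, 0 <= t -> f t = a ij.1 ij.2 t}].
  move=> [i j]; have [_|ji] := eqVneq j i; first by exists 0.
  have [ia a0] := ha _ _ ji.
  by have [f fP] := borel_representative_ge0 ia a0; exists f.
have /choice[b' b'P] : forall ik : V * VL, exists f : R -> R,
    [/\ locally_integrable setT f, forall t, 0 <= f t &
      {ae mu, forall t, 0 <= t -> f t = b ik.1 ik.2 t}].
  by move=> [i k]; have [ib b0] := hb i k; exact: borel_representative_ge0.
have /choice[h' h'P] : forall ij : V * V, exists f : R -> R, ij.2 != ij.1 ->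
    [/\ measurable_fun setT f, forall t, 0 <= f t <= hbar &
      {ae mu, forall t, 0 <= t -> f t = h ij.1 ij.2 t}].
  move=> [i j]; have [_|ji] := eqVneq j i; first by exists 0.
  have [mh h0] := hh _ _ ji.
  have [|f mf fh] := borel_representative _ mh; first exact/borel_lebesgue.
  exists (fun t => Num.max 0 (Num.min hbar (f t))) => _; split.
  - by apply: measurable_maxr => //; exact: measurable_minr.
  - by move=> t; rewrite le_max lexx/= ge_max hbar0 ge_min lexx.
  - move: fh; apply: filterS => t; rewrite /= in_itv/= andbT => fh t0.
    have /andP[h0t hbt] := h0 _ t0.
    by rewrite fh// (min_idPr _)// (max_idPr _).
exists (fun i j => a' (i, j)), (fun i j => h' (i, j)), (fun i k => b' (i, k)).
split.
- by move=> i j ji; have [] := a'P (i, j) ji.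
- by move=> i k; have [] := b'P (i, k).
- by move=> i j ji; have [] := h'P (i, j) ji.
have aea : {ae mu, forall t, forall ij : V * V, ij.2 != ij.1 -> 0 <= t ->
    a' ij t = a ij.1 ij.2 t /\ h' ij t = h ij.1 ij.2 t}.
  apply: filter_forall => ij.
  have [ji|ji] := eqVneq ij.2 ij.1; first exact: nearW.
  have [_ _ H1] := a'P _ ji; have [_ _ H2] := h'P _ ji.
  by apply: filterS2 H1 H2 => t H1 H2 _ t0; split; [exact: H1|exact: H2].
have aeb : {ae mu, forall t, forall ik : V * VL, 0 <= t ->
    b' ik t = b ik.1 ik.2 t}.
  by apply: filter_forall => ik; have [_ _] := b'P ik.
apply: filterS2 aea aeb => t ea eb t0 i; split => [j ji|k].
  exact: (ea (i, j)).
exact: (eb (i, k)).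
Qed.

End borel_coefficients.

Section damped_and_forced.
Context {R : realType} {V VL : finType}.
Implicit Types (a h : V -> V -> R -> R) (d g : V -> R -> R).

Lemma forced_field0 a h d : forced_field a h d (fun _ _ => 0) = damped_field a h d.
Proof. by do 3 (apply/funext => ?); rewrite /forced_field addr0. Qed.

Lemma forced_solution_sum a h d g ts hbar x0 phi x (gk : VL -> V -> R -> R)
    (y : VL -> V -> R -> R) (c : VL -> R) :
  is_solution (forced_field a h d g) ts hbar x0 phi x ->
  (forall k, is_solution (forced_field a h d (gk k)) ts hbar
     (fun=> 0) (fun _ _ => 0) (y k)) ->
  is_solution (forced_field a h d (fun i t => g i t + \sum_k c k * gk k i t))
    ts hbar x0 phi (fun i t => x i t + \sum_k c k * y k i t).
Proof.
move=> xsol ysol; elim: (index_enum VL) => [|k s IH].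
  have e0 (T : Type) (f : V -> T -> R) (F : VL -> V -> T -> R) :
      (fun i t => f i t + \sum_(k <- [::]) c k * F k i t) = f.
    by do 2 (apply/funext => ?); rewrite big_nil addr0.
  by rewrite !e0.
have := forced_solution_lin (c k) IH (ysol k).
have ec (T : Type) (f : V -> T -> R) (F : VL -> V -> T -> R) :
    (fun i t => f i t + \sum_(k <- s) c k * F k i t + c k * F k i t) =
    (fun i t => f i t + \sum_(k <- k :: s) c k * F k i t).
  by do 2 (apply/funext => ?); rewrite big_cons -addrA [_ + c k * _]addrC.
rewrite !ec.
have -> : (fun i => x0 i + c k * 0) = x0 by apply/funext => i; rewrite mulr0 addr0.
have -> // : (fun i s => phi i s + c k * 0) = phi.
by do 2 (apply/funext => ?); rewrite mulr0 addr0.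
Qed.

Lemma eq_forced_field a a' h h' d d' g g' x i t :
  (forall j, j != i -> a' i j t = a i j t /\ h' i j t = h i j t) ->
  d' i t = d i t -> g' i t = g i t ->
  forced_field a h d g x i t = forced_field a' h' d' g' x i t.
Proof.
move=> ah di gi; rewrite /forced_field /damped_field di gi; congr (_ + _ + _).
by apply: eq_bigr => j ji; have [-> ->] := ah _ ji.
Qed.

Lemma coord_containment_field (m : nat) a h (b : V -> VL -> R -> R)
    (xL : VL -> 'rV[R]_m) x i t (c : 'I_m) :
  (containment_field a h b xL x i t) ord0 c =
  forced_field a h (fun i t => \sum_k b i k t)
    (fun i t => \sum_k xL k ord0 c * b i k t) (fun j s => x j s ord0 c) i t.
Proof.
rewrite /containment_field /forced_field /damped_field /averaging !mxE !summxE.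
rewrite addrAC [RHS]addrC; congr (_ + _).
  by apply: eq_bigr => j _; rewrite !mxE.
rewrite mulNr mulr_suml -sumrN -big_split/=; apply: eq_bigr => k _.
by rewrite !mxE; ring.
Qed.

End damped_and_forced.

(** * Containment and asymptotic stability *)

Section coefficients.
Context {R : realType} {V VL : finType}.
Notation mu := (@lebesgue_measure R).
Variables (hbar : R) (a h : V -> V -> R -> R) (b : V -> VL -> R -> R).
Hypothesis hbar0 : 0 <= hbar.
Hypothesis ha : forall i j, j != i -> locally_lebesgue_integrable (a i j) /\
  forall t, 0 <= t -> 0 <= a i j t.
Hypothesis hb : forall i k, locally_lebesgue_integrable (b i k) /\
  forall t, 0 <= t -> 0 <= b i k t.
Hypothesis hh : forall i j, j != i -> lebesgue_measurable `[0, +oo[ (h i j) /\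
  forall t, 0 <= t -> 0 <= h i j t <= hbar.

Let d i t := \sum_k b i k t.

Lemma forced_by_leaders_ge0 (g : V -> R -> R) ts x0 phi x : 0 <= ts ->
  (forall i t, 0 <= t -> 0 <= g i t) ->
  is_solution (forced_field a h d g) ts hbar x0 phi x ->
  (forall i, 0 <= x0 i) ->
  (forall i s, - hbar <= s < 0 -> 0 <= phi i s) ->
  forall i t, ts <= t -> 0 <= x i t.
Proof.
move=> ts0 g0 xsol.
have [a' [h' [b' [a'P b'P h'P aeE]]]] := borel_coefficients hbar0 ha hb hh.
apply: (forced_solution_ge0 (a := a') (h := h') (d := fun i t => \sum_k b' i k t) (g := g)).
- by move=> i j ji; have [ia a0] := a'P _ _ ji; split.
- move=> i; split; first by apply: locally_integrable_sum => k _; exact: (b'P i k).1.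
  by move=> t _; apply: sumr_ge0 => k _; exact: (b'P i k).2.
- by move=> i j ji t _; exact: (h'P _ _ ji).2.
- by move=> i t tst; apply: g0; exact: le_trans tst.
- apply: eq_ae_solution xsol; move: aeE.
  apply: filterS; first exact: (ae_filter_ringOfSetsType mu).
  move=> t aeE tst i; have [ae_a ae_b] := aeE (le_trans ts0 tst) i.
  by apply: eq_forced_field => //; apply: eq_bigr => k _.
Qed.

(** The influence of leader [k]: the response to a unit value at [k] and zero
    everywhere else. *)
Lemma leader_influence_exists ts k : 0 <= ts -> exists y,
  is_solution (forced_field a h d (fun i => b i k)) ts hbar
    (fun=> 0) (fun _ _ => 0) y.
Proof.
move=> ts0.
have [a' [h' [b' [a'P b'P h'P aeE]]]] := borel_coefficients hbar0 ha hb hh.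
have [|||| y ysol] := @forced_solution_exists _ _ a' h'
    (fun i t => \sum_k b' i k t) (fun i => b' i k) ts hbar.
- by [].
- by move=> i; apply: locally_integrable_sum => k' _; exact: (b'P i k').1.
- by move=> i j ji; exact: (h'P _ _ ji).1.
- move=> i; have [ib b0] := b'P i k; split => // t; rewrite b0/=.
  by rewrite (bigD1 k)//= lerDl; apply: sumr_ge0 => k' _; exact: (b'P i k').2.
exists y; apply: eq_ae_solution ysol; move: aeE.
apply: filterS; first exact: (ae_filter_ringOfSetsType mu).
move=> t aeE tst i; have [ae_a ae_b] := aeE (le_trans ts0 tst) i.
apply: eq_forced_field => // [j ji|].
- by have [-> ->] := ae_a _ ji.
- by apply: eq_bigr => k' _; rewrite ae_b.
Qed.

(** The constant [M = e / 2] solves the dynamics with the nonnegative input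
    [M * d]; hence so do [M + x] and [M - x], and both stay nonnegative. *)
Lemma damped_lyapunov_stable : lyapunov_stable hbar a h d.
Proof.
move=> ts e ts0 e0; exists (e / 2); first by rewrite divr_gt0.
move=> x0 phi x _ xsol x0_le phi_le i t tst.
have d0 (c : R) : 0 <= c -> forall i t, 0 <= t -> 0 <= c * d i t.
  by move=> c0 i' t' t0; rewrite mulr_ge0// sumr_ge0// => k _; exact: (hb i' k).2.
have e20 : 0 <= e / 2 by rewrite divr_ge0// ltW.
rewrite -forced_field0 in xsol.
have cst_sol := forced_solution_cst a h d ts hbar (e / 2).
have bound (c : R) : `|c| = 1 -> 0 <= e / 2 + c * x i t.
  move=> c1.
  have cx (y : R) : `|y| <= e / 2 -> 0 <= e / 2 + c * y.
    move=> ye; have : `|c * y| <= e / 2 by rewrite normrM c1 mul1r.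
    by rewrite ler_norml => /andP[]; lra.
  apply: (forced_by_leaders_ge0 ts0 _ (forced_solution_lin c cst_sol xsol)) => //.
  - by move=> i' t' t0; rewrite mulr0 addr0 d0.
  - by move=> i'; apply: cx.
  - by move=> i' s sh; apply: cx; exact: phi_le.
have := bound 1 (normr1 _); have := bound (-1); rewrite normrN1 => /(_ erefl).
by rewrite ltr_norml; lra.
Qed.

(** With all leaders at the origin, the damped dynamics is the containment
    algorithm on the line spanned by [v]. *)
Lemma containment_attractive m : (0 < m)%N -> (0 < #|VL|)%N ->
  provides_containment m hbar a h b -> attractive hbar a h d.
Proof.
case: m => // m _ /card_gt0P[k0 _] contain ts x0 phi x ts0 phi_adm xsol i.
pose v : 'rV[R]_m.+1 := const_mx 1.
have Llin : linear (fun r : R => r *: v).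
  by move=> r u w; rewrite scalerDl scalerA.
pose L : {linear R -> 'rV[R]_m.+1} := HB.pack (fun r : R => r *: v)
  (GRing.isLinear.Build R R 'rV[R]_m.+1 _ (fun r : R => r *: v) Llin).
have L_le r : `|L r| <= `|v| * `|r| by rewrite mulrC -normrZ.
have LF j t : L (damped_field a h d x j t) =
    containment_field a h b (fun=> 0) (fun j s => L (x j s)) j t.
  rewrite /damped_field /containment_field /averaging /= scalerDl addrC scaler_suml.
  congr (_ + _).
    by apply: eq_bigr => j' _; rewrite -scalerBl scalerA.
  rewrite mulNr mulr_suml -sumrN scaler_suml; apply: eq_bigr => k _.
  by rewrite sub0r scalerN scalerA scaleNr.
have Xsol := linear_image_solution L_le LF xsol.
have := contain ts _ _ (fun=> 0) _ ts0 _ Xsol i.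
have LP : admissible_history hbar (fun i s => L (phi i s)).
  by move=> j; exact: (bounded_borel_linear_image L_le (phi_adm j)).
move=> /(_ LP); rewrite (convex_hull_range0 k0)// => dist0.
apply/norm_cvg0P; apply: (squeeze_cvgr _ (cvg_cst 0) dist0).
apply: nearW => t; rewrite normr_ge0/=.
apply: lb_le_inf; first by exists (euclidean_norm (L (x i t) - 0)), 0.
move=> _ [_ -> <-]; rewrite subr0.
apply: le_trans (euclidean_norm_ge_coord _ ord0).
by rewrite /= !mxE mulr1.
Qed.

(** Both [x i - \sum_k w k i *: xL k] and [r = 1 - \sum_k w k i] tend to zero,
    as they obey the damped dynamics, and adding the missing weight [r] to one
    leader [k0] yields a genuine convex combination. *)
Lemma attractive_containment m : (0 < #|VL|)%N ->
  attractive hbar a h d -> provides_containment m hbar a h b.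
Proof.
move=> /card_gt0P[k0 _] attr ts x0 phi xL x ts0 phi_adm xsol i.
have /choice[w wsol] k := leader_influence_exists k ts0.
have w_ge0 k t : ts <= t -> 0 <= w k i t.
  by apply: (forced_by_leaders_ge0 ts0 _ (wsol k)) => // i' t' t0; exact: (hb i' k).2.
pose r t := 1 - \sum_k w k i t.
have rsol := forced_solution_sum (fun=> -1) (forced_solution_cst a h d ts hbar 1) wsol.
have rE t : 1 + \sum_k -1 * w k i t = r t.
  by rewrite /r -sumrN; congr (_ + _); apply: eq_bigr => k _; rewrite mulN1r.
have g0 : (fun i t => 1 * d i t + \sum_k -1 * b i k t) = (fun _ _ => 0).
  do 2 (apply/funext => ?); rewrite mul1r -mulr_sumr mulN1r; exact: subrr.
rewrite g0 in rsol.
have r_ge0 t : ts <= t -> 0 <= r t.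
  by move=> tst; rewrite -rE; exact: (forced_by_leaders_ge0 ts0 _ rsol).
rewrite forced_field0 in rsol.
have r_to0 : r t @[t --> +oo] --> 0.
  have adm1 : admissible_history hbar (fun (_ : V) (_ : R) => 1 : R).
    move=> _; split; first exact: measurable_cst.
    exact: bounded_cst.
  have := attr _ _ _ _ ts0 adm1 rsol i.
  by under eq_cvg do rewrite rE.
pose y (c : 'I_m) t := x i t ord0 c - \sum_k xL k ord0 c * w k i t.
have y_to0 c : y c t @[t --> +oo] --> 0.
  have Llin : linear (fun u : 'rV[R]_m => u ord0 c).
    by move=> s u u'; rewrite !mxE.
  pose L : {linear 'rV[R]_m -> R} := HB.pack (fun u : 'rV[R]_m => u ord0 c)
    (GRing.isLinear.Build R 'rV[R]_m R _ (fun u : 'rV[R]_m => u ord0 c) Llin).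
  have L_le u : `|L u| <= 1 * `|u|.
    rewrite mul1r [leRHS]/Num.norm/= mx_normrE.
    exact: (le_bigmax _ (fun ij => `|u ij.1 ij.2|) (ord0, c)).
  have Lsol := linear_image_solution L_le (fun i t => coord_containment_field a h b xL x i t c) xsol.
  have ysol := forced_solution_sum (fun k => - xL k ord0 c) Lsol wsol.
  have g0' : (fun i t => \sum_k xL k ord0 c * b i k t +
      \sum_k - xL k ord0 c * b i k t) = (fun _ _ => 0).
    do 2 (apply/funext => ?); rewrite -big_split big1//= => k _.
    by rewrite mulNr subrr.
  rewrite g0' forced_field0 in ysol.
  have Ladm : admissible_history hbar (fun i s => L (phi i s)).
    by move=> j; exact: (bounded_borel_linear_image L_le (phi_adm j)).
  have := attr _ _ _ _ ts0 Ladm ysol i.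
  suff -> : (fun t => L (x i t) + \sum_k - xL k ord0 c * w k i t) = y c by [].
  apply/funext => t; rewrite /y -sumrN; congr (_ + _).
  by apply: eq_bigr => k _; rewrite mulNr.
have sum_k0 (f : VL -> R) : \sum_k (k == k0)%:R * f k = f k0.
  rewrite (bigD1 k0)//= eqxx mul1r big1 ?addr0// => k /negPf ->.
  by rewrite mul0r.
pose coef t k := w k i t + (k == k0)%:R * r t.
have coef_hull t : ts <= t -> convex_hull (range xL) (\sum_k coef t k *: xL k).
  move=> tst; apply: convex_hull_sum => [k|].
    by rewrite addr_ge0 ?w_ge0// mulr_ge0 ?r_ge0// ler0n.
  by rewrite big_split/= (sum_k0 (fun=> r t)) /r addrC subrK.
have bound_to0 : \sum_c `|y c t - r t * xL k0 ord0 c| @[t --> +oo] --> 0.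
  have coord_to0 c : `|y c t - r t * xL k0 ord0 c| @[t --> +oo] --> (0 : R).
    have := cvg_norm (cvgB (y_to0 c) (cvgM r_to0 (cvg_cst (xL k0 ord0 c)))).
    by rewrite mul0r subr0 normr0; apply; exact: proper_pinfty_nbhs.
  have := cvg_big add_continuous (F := +oo) (r := index_enum 'I_m) (P := xpredT)
    (Fa := fun=> 0) _ (fun c _ => coord_to0 c).
  by move=> /(_ 0 _); rewrite big1.
apply: (squeeze_cvgr _ (cvg_cst 0) bound_to0).
near=> t; have tst : ts <= t by near: t; apply: nbhs_pinfty_ge; exact: num_real.
rewrite euclidean_dist_ge0/=.
apply: le_trans (euclidean_dist_le _ (coef_hull t tst)) _.
apply: le_trans (euclidean_norm_le_sum _) _.
apply: ler_sum => c _; rewrite !mxE summxE.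
under [X in x i t ord0 c - X]eq_bigr do rewrite mxE mulrDl -mulrA [w _ _ _ * _]mulrC.
by rewrite big_split/= (sum_k0 (fun k => r t * xL k ord0 c)) opprD addrA.
Unshelve. all: by end_near. Qed.

End coefficients.

Theorem lemma8 (R : realType) (V VL : finType) (m : nat) (hbar : R)
    (a h : V -> V -> R -> R) (b : V -> VL -> R -> R) :
  (0 < #|V|)%N -> (0 < #|VL|)%N -> (0 < m)%N -> 0 <= hbar ->
  (forall i j, j != i -> locally_lebesgue_integrable (a i j) /\
     forall t, 0 <= t -> 0 <= a i j t) ->
  (forall i k, locally_lebesgue_integrable (b i k) /\
     forall t, 0 <= t -> 0 <= b i k t) ->
  (forall i j, j != i -> lebesgue_measurable `[0, +oo[ (h i j) /\
     forall t, 0 <= t -> 0 <= h i j t <= hbar) ->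
  provides_containment m hbar a h b <->
  asymptotically_stable hbar a h (fun i t => \sum_k b i k t).
Proof.
move=> _ VL0 m0 hbar0 ha hb hh; split => [contain|[_ attr]].
  split; first exact: damped_lyapunov_stable.
  exact: containment_attractive contain.
exact: attractive_containment.
Qed.
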